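(* Let $G$ be a finite abelian group. The composite map $$T_G^{\mathrm{inv}}=\prod_{H\le G}\left(\mathbb{Z}/[G:H]\right)^\times/\{\pm1\}\xrightarrow{\ \underline{A}^{(-)}\ }\mathrm{Pic}(k\mathrm{Mack}_G)\xrightarrow{\ \mathrm{ev}_{G/G}\ }\mathrm{Pic}(k\mathrm{Mod}_{A(G)})\cong\mathrm{Pic}(A(G)),$$ which sends $\alpha\in T_G^{\mathrm{inv}}$ to the isomorphism class of the corresponding twisted Burnside module $A(G)^\alpha$, is an isomorphism. That is, every invertible $A(G)$-module is isomorphic to a twisted Burnside module.
   Context: The quotient by $\{\pm1\}$ is taken in each factor separately. For a symmetric monoidal category $(\mathcal{C},\otimes,\mathbb{1})$, $\mathrm{Pic}(\mathcal{C})$ is the abelian group of isomorphism classes of $\otimes$-invertible objects; for a commutative ring $R$, $\mathrm{Pic}(R)=\mathrm{Pic}(\mathrm{Mod}_R)$. A dualizable object of $\mathcal{C}$ is a Künneth object if it is a retract of a finite copower of the unit; $k\mathcal{C}$ is the full symmetric monoidal subcategory of Künneth objects. $\mathrm{Mack}_G$ is the category of $G$-Mackey functors, symmetric monoidal under the box product $\boxtimes$ (Day convolution), with unit the Burnside Mackey functor $\underline{A}$, where $\underline{A}(G/H)=A(H)$ is the Burnside ring of $H$ (free abelian on the classes $H/J$, $J\le H$, since $G$ is abelian), with restriction of actions as restrictions and $X\mapsto H\times_J X$ as transfers. The functor $\mathrm{ev}_{G/G}$ sends $\underline{M}$ to $\underline{M}(G/G)$ with $A(G)$-module structure $G/H\cdot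 m=\mathrm{tr}_H^G\mathrm{res}_H^G m$. $T_G=\prod_{H\le G}\mathbb{Z}$, under pointwise multiplication. For $a=(a_H)_{H\le G}\in T_G$ put $r_H=r_H^a=\prod_{K\ge H}a_K$. The $a$-twisted Burnside Mackey functor $\underline{A}^a$ has $\underline{A}^a(G/H)=A(H)$, the same transfers and (trivial) Weyl actions as $\underline{A}$, and restrictions, for $K\le H$, $\mathrm{res}^a_{H,K}(H/J)=\frac{r_{J\cap K}}{r_J}|H/JK|\cdot K/(J\cap K)$ on generators. One may assume $a_G=1$ (this does not affect $\underline{A}^a$). The $a$-twisted Burnside module is $A(G)^a:=\mathrm{ev}_{G/G}\underline{A}^a$. For $\alpha\in T_G^{\mathrm{inv}}$, $\underline{A}^\alpha$ and $A(G)^\alpha$ denote $\underline{A}^a$, $A(G)^a$ for any integer representative $a$ of $\alpha$; the isomorphism classes are independent of the choice. *)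

(* Defs.v *)
From HB Require Import structures.
From mathcomp Require Import all_boot all_order all_algebra all_fingroup all_solvable.

Set Implicit Arguments.
Unset Strict Implicit.
Unset Printing Implicit Defensive.

Import GRing.Theory Num.Theory.
Local Open Scope group_scope.
Local Open Scope ring_scope.

(** * The Burnside rings of the subgroups of a finite abelian group *)

(* The whole type [gT] is the finite abelian group G, its subgroups are the   *)
(* elements of [{group gT}].                                                  *)

Section AbelianGroup.
Variables (gT : finGroupType) (abG : abelian [set: gT]).
Implicit Types H J K L : {group gT}.

Lemma abelian_mulC (A B : {set gT}) : commute A B.
Proof.
apply: centC; apply: subset_trans (subsetT _) _.
apply: subset_trans abG _; apply: centS; exact: subsetT.
Qed.

Lemma abelian_joinE J K : J <*> K = (J * K)%g.
Proof. by apply: comm_joingE; apply: abelian_mulC. Qed.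

Lemma card_join J K : (#|J <*> K| * #|J :&: K| = #|J| * #|K|)%N.
Proof. by rewrite abelian_joinE mul_cardG. Qed.

Lemma abelian_modl J K H : J \subset H ->
  J <*> (H :&: K) = H :&: (J <*> K).
Proof.
move=> sJH; rewrite (abelian_joinE J (H :&: K)%G) (abelian_joinE J K) /=.
by rewrite [H :&: K]setIC group_modl // setIC.
Qed.

Lemma index_meet H J K : J \subset H -> K \subset H ->
  (#|H : J <*> K| * #|H : J :&: K| = #|H : J| * #|H : K|)%N.
Proof.
move=> sJH sKH.
have sJK : J <*> K \subset H by rewrite join_subG sJH.
have sI : J :&: K \subset H by apply: subset_trans sJH; apply: subsetIl.
have gt0 : (0 < #|J| * #|K|)%N by rewrite muln_gt0 !cardG_gt0.
apply/eqP; rewrite -(eqn_pmul2r gt0) -{1}card_join; apply/eqP.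
rewrite mulnACA mulnC [(_ * #|J <*> K|)%N]mulnC Lagrange //.
rewrite [(_ * #|J :&: K|)%N]mulnC Lagrange //.
by rewrite mulnACA [(_ * #|J|)%N]mulnC [(_ * #|K|)%N]mulnC !Lagrange.
Qed.

Lemma index_join H K L : K \subset H -> L \subset H ->
  (#|H : K <*> L| * #|K : K :&: L| = #|H : L|)%N.
Proof.
move=> sKH sLH; rewrite indexgI -indexMg.
have -> : #|L * K : L| = #|K <*> L : L|.
  by rewrite joingC (abelian_joinE L K).
by rewrite Lagrange_index ?joing_subr // join_subG sKH.
Qed.

End AbelianGroup.

Definition subgroup_of (gT : finGroupType) (H : {group gT}) :=
  {J : {group gT} | J \subset H}.

(* A(H) is free on the classes H/J, J <= H: an element is its family of       *)
(* coordinates.  The proof [abG] only serves to make the ring structure       *)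
(* inferable.                                                                 *)
Definition burnside (gT : finGroupType) (abG : abelian [set: gT])
  (H : {group gT}) : Type := {ffun subgroup_of H -> int}.

HB.instance Definition _ (gT : finGroupType) (abG : abelian [set: gT])
  (H : {group gT}) := GRing.Zmodule.on (@burnside gT abG H).

Section BurnsideRing.
Variables (gT : finGroupType) (abG : abelian [set: gT]).
Implicit Types H J K L : {group gT}.

Notation A := (burnside abG).

(* The class of H/J (zero if J is not a subgroup of H). *)
Definition orb H J : A H := [ffun J' : subgroup_of H => (val J' == J)%:Z].

(* The Z-linear extension of a map given on the basis. *)
Definition linext H (V : zmodType) (F : subgroup_of H -> V) (x : A H) : V :=
  \sum_(J : subgroup_of H) F J *~ (x : {ffun _ -> int}) J.

Lemma linext_is_zmod_morphism H (V : zmodType) (F : subgroup_of H -> V) :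
  zmod_morphism (linext F).
Proof.
move=> x y; rewrite /linext -sumrB; apply: eq_bigr => J _.
by rewrite !ffunE mulrzBr.
Qed.

HB.instance Definition _ H (V : zmodType) (F : subgroup_of H -> V) :=
  GRing.isZmodMorphism.Build (A H) V (linext F) (linext_is_zmod_morphism F).

Lemma raddf_linext H (V W : zmodType) (f : {additive V -> W})
  (F : subgroup_of H -> V) x : f (linext F x) = linext (f \o F) x.
Proof. by rewrite raddf_sum; apply: eq_bigr => J _; rewrite raddfMz. Qed.

Lemma linext_orb H (V : zmodType) (F : subgroup_of H -> V) (J : subgroup_of H) :
  linext F (orb H (val J)) = F J.
Proof.
rewrite /linext (bigD1 J) //= ffunE eqxx mulr1z big1 ?addr0 // => K neKJ.
by rewrite ffunE (inj_eq val_inj) (negPf neKJ) mulr0z.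
Qed.

Lemma orb_sum H (x : A H) : x = linext (fun J : subgroup_of H => orb H (val J)) x.
Proof.
apply/ffunP=> J; rewrite /linext sum_ffunE (bigD1 J) //= big1 ?addr0.
  by rewrite ffunMzE ffunE eqxx mulrzz mul1r.
move=> K neKJ; rewrite ffunMzE ffunE (inj_eq val_inj) eq_sym (negPf neKJ).
by rewrite mulrzz mul0r.
Qed.

Lemma orb_ext H (V : zmodType) (f g : {additive A H -> V}) :
  (forall J, J \subset H -> f (orb H J) = g (orb H J)) -> f =1 g.
Proof.
move=> eqfg x; rewrite [x]orb_sum /linext !raddf_sum; apply: eq_bigr => J _.
by rewrite !raddfMz eqfg // (valP J).
Qed.

Lemma linextE H (V : zmodType) (F : {group gT} -> V) J : J \subset H ->
  linext (fun K : subgroup_of H => F (val K)) (orb H J) = F J.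
Proof. by move=> sJH; rewrite (linext_orb _ (Sub J sJH : subgroup_of H)). Qed.

(* H/J * H/K = |H/JK| H/(J n K), the orbit decomposition of the H-set         *)
(* H/J x H/K.                                                                 *)
Definition burnside_mul H (x y : A H) : A H :=
  linext (fun J : subgroup_of H =>
    linext (fun K : subgroup_of H =>
      orb H (val J :&: val K)%G *~ #|H : val J <*> val K|%:Z) y) x.

Definition burnside_one H : A H := orb H H.

(* The mark at L, the ring morphism taking the class of a finite H-set X to   *)
(* the cardinal of X^L (see [markP]).                                         *)
Definition mark H L (x : A H) : int :=
  linext (fun J : subgroup_of H =>
    if L \subset val J then #|H : val J|%:Z else 0) x.

Lemma mark_is_zmod_morphism H L : zmod_morphism (@mark H L).
Proof. exact: linext_is_zmod_morphism. Qed.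

HB.instance Definition _ H L :=
  GRing.isZmodMorphism.Build (A H) int (@mark H L) (@mark_is_zmod_morphism H L).

Lemma mark_orb H L J : J \subset H ->
  mark L (orb H J) = if L \subset J then #|H : J|%:Z else 0.
Proof.
move=> sJH.
exact: (linextE (fun J => if L \subset J then #|H : J|%:Z else 0) sJH).
Qed.

Lemma markP H L J : L \subset H -> J \subset H ->
  mark L (orb H J) = #|'Fix_(rcosets J H | 'Rs)(L)|%:Z.
Proof.
move=> sLH sJH; rewrite mark_orb //.
have mem_fix x l : x \in H -> l \in H -> (J :* x :* l == J :* x) = (l \in J).
  move=> xH lH; rewrite -rcosetM; apply/eqP/idP.
    move=> /rcoset_eqP; rewrite mem_rcoset.
    by rewrite (centsP abG x _ l) ?inE // mulgK.
  move=> lJ; rewrite (centsP abG x _ l) ?inE // rcosetM.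
  by rewrite (rcoset_id lJ).
case: ifPn => [sLJ | nsLJ].
  congr (_%:Z); apply: eq_card => C; rewrite inE andbC.
  case: (boolP (C \in _)) => [/rcosetsP[x xH ->] | _]; last by rewrite andbF.
  rewrite andbT; apply/esym/afixP => l lL /=; rewrite rcosetE.
  by apply/eqP; rewrite (mem_fix x l xH (subsetP sLH l lL)) (subsetP sLJ).
rewrite (_ : 'Fix_(_ | _)(_) = set0) ?cards0 //.
apply/setP => C; rewrite !inE; apply/negP => /andP[/rcosetsP[x xH ->] fixL].
case/subsetP: nsLJ => l lL.
rewrite -(mem_fix x l xH (subsetP sLH l lL)).
move/subsetP/(_ l lL): fixL; rewrite inE => /eqP /=.
by rewrite rcosetE => ->.
Qed.

Lemma mark_mul H L (x y : A H) :
  mark L (burnside_mul x y) = mark L x * mark L y.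
Proof.
rewrite raddf_linext /mark {1 2}/linext mulr_suml; apply: eq_bigr => J _ /=.
rewrite raddf_linext mulrzAl; congr (_ *~ _).
rewrite {1 2}/linext mulr_sumr; apply: eq_bigr => K _ /=.
rewrite mulrzAr; congr (_ *~ _).
rewrite raddfMz /= mark_orb /=; last first.
  by apply: subset_trans (valP J); apply: subsetIl.
rewrite subsetI; case: (L \subset val J); case: (L \subset val K) => /=;
  rewrite ?mul0r ?mulr0 ?mul0rz // mulrzz -!PoszM [in LHS]mulnC.
by rewrite index_meet ?(valP J) ?(valP K).
Qed.

Lemma mark_inj H (x y : A H) :
  (forall L, L \subset H -> mark L x = mark L y) -> x = y.
Proof.
move=> eqxy; apply/eqP; rewrite -subr_eq0; apply/negPn/negP => nz.
set z : A H := x - y in nz.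
have [J0 nzJ0] : exists J : subgroup_of H, (z : {ffun _ -> int}) J != 0.
  apply/existsP; rewrite -negb_forall; apply: contra nz => /forallP z0.
  by apply/eqP/ffunP => J; rewrite (eqP (z0 J)) ffunE.
case: (@arg_maxnP _ J0 (fun J : subgroup_of H => (z : {ffun _ -> int}) J != 0)
  (fun J : subgroup_of H => #|val J|) nzJ0) => J nzJ maxJ.
have : mark (val J) z = 0 by rewrite raddfB /= eqxy ?subrr // (valP J).
rewrite /mark /linext (bigD1 J) //= subxx big1 ?addr0 => [/eqP|K neKJ].
  by rewrite mulrzz mulf_eq0 (negPf nzJ) orbF eqz_nat eqn0Ngt indexg_gt0.
case: ifP => sJK; last by rewrite mul0rz.
have [zK0 | nzK] := eqVneq ((z : {ffun _ -> int}) K) 0; first by rewrite zK0 mulr0z.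
case/eqP: neKJ; apply/val_inj/val_inj/esym/eqP; rewrite eqEcard sJK /=.
exact: maxJ.
Qed.

Lemma burnside_mulA H : associative (@burnside_mul H).
Proof. by move=> x y z; apply: mark_inj => L _; rewrite !mark_mul mulrA. Qed.

Lemma burnside_mulC H : commutative (@burnside_mul H).
Proof. by move=> x y; apply: mark_inj => L _; rewrite !mark_mul mulrC. Qed.

Lemma burnside_mul1 H : left_id (burnside_one H) (@burnside_mul H).
Proof.
move=> x; apply: mark_inj => L sLH; rewrite mark_mul mark_orb //.
by rewrite sLH indexgg mul1r.
Qed.

Lemma burnside_mulDl H : left_distributive (@burnside_mul H) +%R.
Proof.
by move=> x y z; apply: mark_inj => L _; rewrite raddfD /= !mark_mul raddfD mulrDl.
Qed.

Lemma burnside_one_neq0 H : burnside_one H != 0.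
Proof.
apply/eqP => /(congr1 (mark H)); rewrite mark_orb // raddf0 subxx indexgg.
by [].
Qed.

HB.instance Definition _ H := GRing.Zmodule_isComNzRing.Build (A H)
  (@burnside_mulA H) (@burnside_mulC H) (@burnside_mul1 H) (@burnside_mulDl H)
  (burnside_one_neq0 H).

Lemma orbM H J K : J \subset H -> K \subset H ->
  orb H J * orb H K = orb H (J :&: K)%G *~ #|H : J <*> K|%:Z.
Proof.
move=> sJH sKH; rewrite -[LHS]/(burnside_mul _ _) /burnside_mul.
set F := fun J : {group gT} => linext (fun K : subgroup_of H =>
  orb H (J :&: val K)%G *~ #|H : J <*> val K|%:Z) (orb H K).
rewrite (linextE F sJH) /F.
exact: (linextE (fun K => orb H (J :&: K)%G *~ #|H : J <*> K|%:Z) sKH).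
Qed.

End BurnsideRing.

(** * Mackey functors *)

(* M(G/H) is written [M H].  As G is abelian, conjugation by g is an          *)
(* endomorphism [mact g H] of M(G/H), i.e. the action of the Weyl group G/H.  *)
(* Restrictions [mres H K : M H -> M K] and transfers [mtr K H : M K -> M H]  *)
(* are meaningful for K <= H only: their values for other pairs of subgroups  *)
(* are irrelevant, and nothing below refers to them.                          *)
Record mackey (gT : finGroupType) := Mackey {
  mval :> {group gT} -> zmodType;
  mres : forall H K : {group gT}, {additive mval H -> mval K};
  mtr : forall K H : {group gT}, {additive mval K -> mval H};
  mact : gT -> forall H : {group gT}, {additive mval H -> mval H};
  mres_id : forall (H : {group gT}) x, mres H H x = x;
  mtr_id : forall (H : {group gT}) x, mtr H H x = x;
  mres_comp : forall (H K L : {group gT}) x, L \subset K -> K \subset H ->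
    mres K L (mres H K x) = mres H L x;
  mtr_comp : forall (H K L : {group gT}) x, L \subset K -> K \subset H ->
    mtr K H (mtr L K x) = mtr L H x;
  mactM : forall g h (H : {group gT}) x,
    mact (g * h)%g H x = mact g H (mact h H x);
  mact_in : forall g (H : {group gT}) x, g \in H -> mact g H x = x;
  mres_act : forall g (H K : {group gT}) x, K \subset H ->
    mres H K (mact g H x) = mact g K (mres H K x);
  mtr_act : forall g (H K : {group gT}) x, K \subset H ->
    mtr K H (mact g K x) = mact g H (mtr K H x);
  (* the double coset formula; the double cosets of H and K in L are the      *)
  (* cosets of HK in L                                                        *)
  mres_tr : forall (H K L : {group gT}) x, H \subset L -> K \subset L ->
    mres L K (mtr H L x) =
      \sum_(C in rcosets (H <*> K) L)
        mtr (H :&: K)%G K (mact (repr C) (H :&: K)%G (mres H (H :&: K)%G x))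
}.

Record mackey_hom (gT : finGroupType) (M N : mackey gT) := MackeyHom {
  mhom :> forall H : {group gT}, {additive M H -> N H};
  mhom_res : forall (H K : {group gT}) x, K \subset H ->
    mhom K (mres M H K x) = mres N H K (mhom H x);
  mhom_tr : forall (H K : {group gT}) x, K \subset H ->
    mhom H (mtr M K H x) = mtr N K H (mhom K x);
  mhom_act : forall g (H : {group gT}) x,
    mhom H (mact M g H x) = mact N g H (mhom H x)
}.

Definition mackey_iso (gT : finGroupType) (M N : mackey gT) : Prop :=
  exists (f : mackey_hom M N) (g : mackey_hom N M),
    forall H, cancel (f H) (g H) /\ cancel (g H) (f H).

(* P is a retract of M: id_P factors through M. *)
Definition mackey_retract (gT : finGroupType) (P M : mackey gT) : Prop :=
  exists (i : mackey_hom P M) (p : mackey_hom M P), forall H, cancel (i H) (p H).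

(** ** The box product *)

(* By Day convolution, morphisms from the box product of M and N to P are the *)
(* families M(X) x N(Y) -> P(X x Y) of biadditive maps that are natural in    *)
(* the G-sets X and Y; restricting them along the diagonals of the orbits     *)
(* identifies them with the following (Dress) pairings.                       *)
Record mackey_pairing (gT : finGroupType) (M N P : mackey gT)
    (t : forall H : {group gT}, M H -> N H -> P H) : Prop := MackeyPairing {
  pairingDl : forall H x x' y, t H (x + x') y = t H x y + t H x' y;
  pairingDr : forall H x y y', t H x (y + y') = t H x y + t H x y';
  pairing_res : forall (H K : {group gT}) x y, K \subset H ->
    mres P H K (t H x y) = t K (mres M H K x) (mres N H K y);
  pairing_act : forall g (H : {group gT}) x y,
    mact P g H (t H x y) = t H (mact M g H x) (mact N g H y);
  pairing_trl : forall (H K : {group gT}) x y, K \subset H ->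
    t H (mtr M K H x) y = mtr P K H (t K x (mres N H K y));
  pairing_trr : forall (H K : {group gT}) x y, K \subset H ->
    t H x (mtr N K H y) = mtr P K H (t K (mres M H K x) y)
}.

(* P is a box product of M and N. *)
Definition mackey_box (gT : finGroupType) (M N P : mackey gT) : Prop :=
  exists2 t : forall H : {group gT}, M H -> N H -> P H, mackey_pairing t &
    forall (Q : mackey gT) (s : forall H : {group gT}, M H -> N H -> Q H),
      mackey_pairing s ->
      exists2 f : mackey_hom P Q, (forall H x y, f H (t H x y) = s H x y) &
        forall f' : mackey_hom P Q,
          (forall H x y, f' H (t H x y) = s H x y) -> forall H, f' H =1 f H.

(** ** Finite copowers *)

Section Copower.
Variables (gT : finGroupType) (M : mackey gT) (n : nat).
Implicit Types H K L : {group gT}.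

Definition ffun_map (U V : zmodType) (f : U -> V) (x : {ffun 'I_n -> U}) :
  {ffun 'I_n -> V} := [ffun i => f (x i)].

Lemma ffun_map_is_zmod_morphism (U V : zmodType) (f : {additive U -> V}) :
  zmod_morphism (ffun_map f).
Proof. by move=> x y; apply/ffunP => i; rewrite !ffunE raddfB. Qed.

HB.instance Definition _ (U V : zmodType) (f : {additive U -> V}) :=
  GRing.isZmodMorphism.Build {ffun 'I_n -> U} {ffun 'I_n -> V} (ffun_map f)
    (ffun_map_is_zmod_morphism f).

Definition mackey_copower : mackey gT.
Proof.
unshelve refine (@Mackey gT (fun H => {ffun 'I_n -> M H} : zmodType)
  (fun H K => ffun_map (mres M H K)) (fun K H => ffun_map (mtr M K H))
  (fun g H => ffun_map (mact M g H)) _ _ _ _ _ _ _ _ _).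
- by move=> H x; apply/ffunP => i; rewrite !ffunE mres_id.
- by move=> H x; apply/ffunP => i; rewrite !ffunE mtr_id.
- by move=> H K L x sLK sKH; apply/ffunP => i; rewrite !ffunE mres_comp.
- by move=> H K L x sLK sKH; apply/ffunP => i; rewrite !ffunE mtr_comp.
- by move=> g h H x; apply/ffunP => i; rewrite !ffunE mactM.
- by move=> g H x gH; apply/ffunP => i; rewrite !ffunE mact_in.
- by move=> g H K x sKH; apply/ffunP => i; rewrite !ffunE mres_act.
- by move=> g H K x sKH; apply/ffunP => i; rewrite !ffunE mtr_act.
move=> H K L x sHL sKL; apply/ffunP => i; rewrite !ffunE mres_tr // sum_ffunE.
by apply: eq_bigr => C _; rewrite !ffunE.
Defined.

End Copower.

(** ** Evaluation at G/G *)

Definition ev_type (gT : finGroupType) (abG : abelian [set: gT])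
  (M : mackey gT) : Type := M [set: gT]%G.

HB.instance Definition _ (gT : finGroupType) (abG : abelian [set: gT])
  (M : mackey gT) := GRing.Zmodule.on (@ev_type gT abG M).

Section Evaluation.
Variables (gT : finGroupType) (abG : abelian [set: gT]).
Implicit Types H J K L : {group gT}.

Notation G := [set: gT]%G.
Notation AG := (burnside abG G).

Variable M : mackey gT.

(* G/J . m = tr_J^G (res^G_J m) *)
Definition ev_scale (x : AG) (m : ev_type abG M) : ev_type abG M :=
  linext (fun J : subgroup_of G => mtr M (val J) G (mres M G (val J) m)) x.

Lemma mtr_res_tr H K (m : M K) :
  mtr M H G (mres M G H (mtr M K G m)) =
    mtr M (K :&: H)%G G (mres M K (K :&: H)%G m) *~ #|G : K <*> H|%:Z.
Proof.
rewrite mres_tr ?subsetT // raddf_sum /= -pmulrn -sumr_const.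
apply: eq_bigr => C _.
rewrite mtr_comp ?subsetIr ?subsetT // mtr_act ?subsetT //.
by rewrite mact_in ?inE.
Qed.

Lemma ev_scaleA x y m : ev_scale x (ev_scale y m) = ev_scale (x * y) m.
Proof.
rewrite -[x * y]/(burnside_mul x y) /ev_scale /burnside_mul.
rewrite [RHS]raddf_linext; apply: eq_bigr => J _; congr (_ *~ _) => /=.
rewrite [RHS]raddf_linext (raddf_linext (mres M G (val J))).
rewrite (raddf_linext (mtr M (val J) G)).
apply: eq_bigr => K _; congr (_ *~ _) => /=.
rewrite mtr_res_tr raddfMz /=.
rewrite (linextE abG (fun L => mtr M L G (mres M G L m))) ?subsetT //.
rewrite mres_comp ?subsetIl ?subsetT //.
have -> : (val J :&: val K)%G = (val K :&: val J)%G.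
  by apply/val_inj; rewrite /= setIC.
by rewrite joingC.
Qed.

Lemma ev_scale1 : left_id 1 ev_scale.
Proof.
move=> m; rewrite /ev_scale (linextE abG (fun L => mtr M L G (mres M G L m))) //.
by rewrite mres_id mtr_id.
Qed.

Lemma ev_scaleDr : right_distributive ev_scale +%R.
Proof.
move=> x m m'; rewrite /ev_scale /linext -big_split /=; apply: eq_bigr => J _.
by rewrite !raddfD mulrzDl.
Qed.

Lemma ev_scaleDl m : {morph ev_scale^~ m : x y / x + y}.
Proof. by move=> x y; rewrite /ev_scale raddfD. Qed.

HB.instance Definition _ := GRing.Zmodule_isLmodule.Build AG (ev_type abG M)
  ev_scaleA ev_scale1 ev_scaleDr ev_scaleDl.

Definition ev : lmodType AG := ev_type abG M.

End Evaluation.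

(** * Twisted Burnside Mackey functors *)

(* T_G *)
Definition twist (gT : finGroupType) := {ffun {group gT} -> int}.

Section TwistedBurnside.
Variables (gT : finGroupType) (abG : abelian [set: gT]) (a : twist gT).
Implicit Types H J K L : {group gT}.

(* r_H *)
Definition twist_r H : int := \prod_(K : {group gT} | H \subset K) a K.

(* The quotient r_L / r_J for L <= J, see [twist_ratioP].  Defining it as the *)
(* product of the remaining factors makes sense even when r_J = 0, and shows  *)
(* that the value of a at G is irrelevant.                                    *)
Definition twist_ratio J L : int :=
  \prod_(K : {group gT} | (L \subset K) && ~~ (J \subset K)) a K.

Lemma twist_ratioP J L : L \subset J ->
  twist_r L = twist_ratio J L * twist_r J.
Proof.
move=> sLJ; rewrite /twist_r (bigID (fun K : {group gT} => J \subset K)) /=.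
rewrite mulrC; congr (_ * _); apply: eq_bigl => K.
by apply: andb_idl; apply: subset_trans.
Qed.

Lemma twist_ratio_id J : twist_ratio J J = 1.
Proof. by rewrite /twist_ratio big_pred0 // => K; rewrite andbN. Qed.

Lemma twist_ratioM J K L : K \subset J -> L \subset K ->
  twist_ratio K L * twist_ratio J K = twist_ratio J L.
Proof.
move=> sKJ sLK; rewrite {3}/twist_ratio.
rewrite (bigID (fun M : {group gT} => K \subset M)) /= mulrC.
congr (_ * _); apply: eq_bigl => M.
  case sKM: (K \subset M); last by rewrite andbF.
  by rewrite (subset_trans sLK sKM) andbT.
rewrite -andbA; congr (_ && _); apply/esym/andb_idl; apply: contra.
exact: subset_trans.
Qed.

Definition twisted_res H K : burnside abG H -> burnside abG K :=
  linext (fun J : subgroup_of H =>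
    orb abG K (val J :&: K)%G *~
      (twist_ratio (val J) (val J :&: K)%G * #|H : val J <*> K|%:Z)).

Definition twisted_tr K H : burnside abG K -> burnside abG H :=
  linext (fun J : subgroup_of K => orb abG H (val J)).

HB.instance Definition _ H K := GRing.isZmodMorphism.Build
  (burnside abG H) (burnside abG K) (@twisted_res H K)
  (linext_is_zmod_morphism _).

HB.instance Definition _ K H := GRing.isZmodMorphism.Build
  (burnside abG K) (burnside abG H) (@twisted_tr K H)
  (linext_is_zmod_morphism _).

Lemma twisted_res_orb H K J : J \subset H ->
  twisted_res K (orb abG H J) =
    orb abG K (J :&: K)%G *~ (twist_ratio J (J :&: K)%G * #|H : J <*> K|%:Z).
Proof.
move=> sJH; exact: (linextE abG (fun J => orb abG K (J :&: K)%G *~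
  (twist_ratio J (J :&: K)%G * #|H : J <*> K|%:Z)) sJH).
Qed.

Lemma twisted_tr_orb H K J : J \subset K ->
  twisted_tr H (orb abG K J) = orb abG H J.
Proof. by move=> sJK; exact: (linextE abG (fun J => orb abG H J) sJK). Qed.

Lemma twisted_res_id H x : twisted_res H x = x :> burnside abG H.
Proof.
apply: (@orb_ext _ _ _ _ (@twisted_res H H) idfun) => J sJH /=.
rewrite twisted_res_orb //.
have -> : (J :&: H)%G = J by apply/val_inj/setIidPl.
have -> : J <*> H = H by apply/joing_idPr.
by rewrite twist_ratio_id indexgg mulr1.
Qed.

Lemma twisted_tr_id H x : twisted_tr H x = x :> burnside abG H.
Proof.
apply: (@orb_ext _ _ _ _ (@twisted_tr H H) idfun) => J sJH /=.
by rewrite twisted_tr_orb.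
Qed.

Lemma twisted_tr_comp H K L (x : burnside abG L) : L \subset K -> K \subset H ->
  twisted_tr H (twisted_tr K x) = twisted_tr H x.
Proof.
move=> sLK sKH; apply: (@orb_ext _ _ _ _
  (@twisted_tr K H \o @twisted_tr L K) (@twisted_tr L H)) => J sJL /=.
by rewrite !twisted_tr_orb // (subset_trans sJL).
Qed.

Lemma twisted_res_comp H K L (x : burnside abG H) :
    L \subset K -> K \subset H ->
  twisted_res L (twisted_res K x) = twisted_res L x.
Proof.
move=> sLK sKH; apply: (@orb_ext _ _ _ _
  (@twisted_res K L \o @twisted_res H K) (@twisted_res H L)) => J sJH /=.
rewrite !twisted_res_orb // raddfMz /= twisted_res_orb ?subsetIr //.
have -> : (J :&: K :&: L)%G = (J :&: L)%G.
  by apply/val_inj; rewrite /= -setIA (setIidPr sLK).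
rewrite -mulrzA; congr (_ *~ _).
rewrite [LHS]mulrACA twist_ratioM ?subsetIl ?setIS // -PoszM.
congr (_ * _%:Z).
have sJLH : J <*> L \subset H by rewrite join_subG sJH (subset_trans sLK).
have -> : (J :&: K) <*> L = K :&: (J <*> L).
  by rewrite joingC setIC abelian_modl // joingC.
rewrite mulnC -(index_join abG sKH sJLH) joingA.
congr (#|_ : _| * _)%N.
by rewrite [K <*> J]joingC -joingA (joing_idPl sLK).
Qed.

Lemma twisted_res_tr H K L (x : burnside abG H) :
    H \subset L -> K \subset L ->
  twisted_res K (twisted_tr L x) =
    \sum_(C in rcosets (H <*> K) L)
      twisted_tr K (twisted_res (H :&: K)%G x).
Proof.
move=> sHL sKL; rewrite sumr_const pmulrn [x]orb_sum.
rewrite (raddf_linext (@twisted_tr H L)) (raddf_linext (@twisted_res L K)).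
rewrite (raddf_linext (@twisted_res H (H :&: K)%G)).
rewrite (raddf_linext (@twisted_tr (H :&: K)%G K)).
rewrite /linext mulrz_suml; apply: eq_bigr => -[J sJH] _ /=.
rewrite mulrzAC; congr (_ *~ _).
rewrite twisted_tr_orb // twisted_res_orb ?(subset_trans sJH) //.
rewrite twisted_res_orb // raddfMz /=.
have -> : (J :&: (H :&: K))%G = (J :&: K)%G.
  by apply/val_inj; rewrite /= setIA (setIidPl sJH).
rewrite twisted_tr_orb; last by rewrite /= setSI.
rewrite -mulrzA -mulrA -PoszM; congr (_ *~ (_ * _%:Z)).
have sJKL : J <*> K \subset L by rewrite join_subG sKL (subset_trans sJH).
rewrite abelian_modl // mulnC -(index_join abG sHL sJKL) joingA.
by rewrite (joing_idPl sJH).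
Qed.

Definition twisted_mackey : mackey gT.
Proof.
unshelve refine (@Mackey gT (fun H => burnside abG H : zmodType)
  (fun H K => @twisted_res H K) (fun K H => @twisted_tr K H)
  (fun g H => idfun) _ _ _ _ _ _ _ _ _) => //=.
- exact: twisted_res_id.
- exact: twisted_tr_id.
- exact: twisted_res_comp.
- exact: twisted_tr_comp.
- exact: twisted_res_tr.
Defined.

End TwistedBurnside.

(* The Burnside Mackey functor, the unit for the box product. *)
Definition burnside_mackey (gT : finGroupType) (abG : abelian [set: gT]) :
  mackey gT := twisted_mackey abG [ffun=> 1].

(* A(G)^a *)
Definition twisted_module (gT : finGroupType) (abG : abelian [set: gT])
    (a : twist gT) : lmodType (burnside abG [set: gT]%G) :=
  ev abG (twisted_mackey abG a).

(** * Modules over a commutative ring *)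

Section Modules.
Variable R : comNzRingType.
Implicit Types M N P Q : lmodType R.

Definition module_iso M N : Prop := exists f : {linear M -> N}, bijective f.

Definition bilinear_map M N P (t : M -> N -> P) : Prop :=
  (forall y, linear (t^~ y)) /\ (forall x, linear (t x)).

(* P is a tensor product of M and N. *)
Definition module_tensor M N P : Prop :=
  exists2 t : M -> N -> P, bilinear_map t &
    forall (Q : lmodType R) (s : M -> N -> Q), bilinear_map s ->
      exists2 f : {linear P -> Q}, (forall x y, f (t x y) = s x y) &
        forall f' : {linear P -> Q},
          (forall x y, f' (t x y) = s x y) -> f' =1 f.

Definition module_invertible M : Prop := exists N, module_tensor M N R^o.

End Modules.

(** * Picard groups *)

(* Isomorphism classes are represented by predicates on objects, and the      *)
(* group law of a Picard group is induced by the tensor product.  In the      *)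
(* categories of Kuenneth objects, both an object and its inverse have to be  *)
(* Kuenneth.  A retract of a finite copower of the unit is automatically      *)
(* dualizable.                                                                *)

Definition kunneth_mackey (gT : finGroupType) (abG : abelian [set: gT])
    (M : mackey gT) : Prop :=
  exists n, mackey_retract M (mackey_copower (burnside_mackey abG) n).

Definition Pic_kMack (gT : finGroupType) (abG : abelian [set: gT])
    (C : mackey gT -> Prop) : Prop :=
  exists M N, [/\ kunneth_mackey abG M, kunneth_mackey abG N,
    mackey_box M N (burnside_mackey abG) & C = mackey_iso M].

Section ModulePicard.
Variable R : comNzRingType.

Definition kunneth_module (M : lmodType R) : Prop :=
  exists n (i : {linear M -> {ffun 'I_n -> R^o}})
    (p : {linear {ffun 'I_n -> R^o} -> M}), cancel i p.

Definition Pic_kMod (C : lmodType R -> Prop) : Prop :=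
  exists M N, [/\ kunneth_module M, kunneth_module N,
    module_tensor M N R^o & C = module_iso M].

Definition Pic (C : lmodType R -> Prop) : Prop :=
  exists2 M, module_invertible M & C = module_iso M.

Definition Pic_mul (C D : lmodType R -> Prop) (P : lmodType R) : Prop :=
  exists M N, [/\ C M, D N & module_tensor M N P].

End ModulePicard.

(** * The group of twists and the twisted Burnside modules *)

Definition pm1 (n : nat) : {group {unit 'Z_n}} :=
  <[FinRing.Unit (unitrN1 'Z_n)]>%G.

(* For H = G the ring 'Z_1 is Z/2 instead of the zero ring; both have trivial *)
(* unit groups.                                                               *)
Definition T_inv (gT : finGroupType) : finGroupType :=
  {dffun forall H : {group gT}, coset_of (pm1 #|[set: gT] : H|)}.

(* a is an integer representative of alpha.  The congruence is taken in Z and *)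
(* is vacuous for H = G, as it should.                                        *)
Definition represents (gT : finGroupType) (a : twist gT) (alpha : T_inv gT) :
    Prop :=
  forall H : {group gT}, exists2 u : {unit 'Z_#|[set: gT] : H|},
    (a H = (val u : nat)%:Z %[mod #|[set: gT] : H|])%Z &
    (alpha : {dffun forall H, _}) H = coset _ u.

(* The isomorphism class of A^alpha. *)
Definition twisted_class (gT : finGroupType) (abG : abelian [set: gT])
    (alpha : T_inv gT) (M : mackey gT) : Prop :=
  exists2 a, represents a alpha & mackey_iso (twisted_mackey abG a) M.

(* The map induced by ev_{G/G} on isomorphism classes. *)
Definition ev_class (gT : finGroupType) (abG : abelian [set: gT])
    (C : mackey gT -> Prop) (N : lmodType (burnside abG [set: gT]%G)) : Prop :=
  exists2 M, C M & module_iso (ev abG M) N.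

Definition twisted_module_class (gT : finGroupType) (abG : abelian [set: gT])
    (alpha : T_inv gT) : lmodType (burnside abG [set: gT]%G) -> Prop :=
  ev_class (twisted_class abG alpha).

Arguments twisted_module_class {gT} abG alpha _.

(* Main.v *)
Require Import Defs.
From HB Require Import structures.
From mathcomp Require Import all_boot all_order all_algebra all_fingroup all_solvable.
From mathcomp Require Import boolp ring.

Set Implicit Arguments.
Unset Strict Implicit.
Unset Printing Implicit Defensive.

Import GRing.Theory Num.Theory.
Local Open Scope group_scope.
Local Open Scope ring_scope.

(** Twisted Burnside functors are treated as fractional ideals.  The twisted
    marks ([tmark]) embed the functor of a twist a into the ghost functor, the
    product of copies of the integers over the subgroups L <= H: the class of
    H/J goes to the family v_J with value |H : J| r_L / r_J at L <= J.  There
    restrictions and transfers forget or rescale coordinates, the action of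
    the Burnside ring is multiplication by marks, and the product of the
    lattices of a and b lies in the lattice of ab ([lattice_mul]).  The lattice
    only depends on the a_H modulo |G : H| ([lattice_congr]), and signs in a
    become signs of the coordinates ([lattice_sign]); so the map is defined on
    classes.  Choosing the inverse b of a prime to a, a Bezout relation writes
    1 as a sum of products ([ex_dual_bases]).  Such a dual basis yields at once
    the retraction from a finite copower of the unit, the universal property
    of the box product with value the Burnside functor, and their analogues
    for modules ([twisted_kunneth], [twisted_box], [marked_kunneth],
    [marked_tensor]); the latter also gives multiplicativity.

    Put n = |G|.  The Burnside ring contains all families divisible by n
    ([ex_delta]).  If a is prime to n, the lattice of a at G/G therefore consists
    of the families congruent modulo n to a multiple of (r_L)_L by an element
    of the Burnside ring ([twisted_principal]).  An isomorphism between twisted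
    modules rescales the coordinates by signs; comparing r for the two twists
    from the top of the subgroup lattice downwards gives the congruences up to
    signs, hence injectivity ([twisted_module_iso_congr]).

    For surjectivity, let t be a universal bilinear map from M x N to the
    Burnside ring.  Its universal property and the absence of nilpotents make
    t of rank one in each mark ([pairing_rank1]) and nondegenerate, so M and N
    embed into the ghost ring, with surjective coordinates on M
    ([ex_coordinate]).  Prime avoidance in the Burnside ring provides e in M and
    f in N all of whose coordinates are prime to n ([ex_coprime_coordinates]).
    As t(e, f) is then invertible modulo n, M is generated by e modulo n and
    contains all multiples of n.  Solving r_L = e_L modulo n for a by Moebius
    inversion ([ex_twist_r]) identifies M with the twisted module of a
    ([pairing_twisted]). *)

Definition twist_mul (gT : finGroupType) (a b : twist gT) : twist gT :=
  [ffun H => a H * b H].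

Definition twist_one (gT : finGroupType) : twist gT := [ffun=> 1].

(** * Twisted marks and the lattices they span *)

Section TwistedMarks.
Variables (gT : finGroupType) (abG : abelian [set: gT]).
Implicit Types (H J K L : {group gT}) (a b c : twist gT)
  (f g : {group gT} -> int).
Notation G := [set: gT]%G.
Notation A := (burnside abG).

Lemma burnside_ind H (P : A H -> Prop) :
  P 0 -> (forall x y, P x -> P y -> P (x - y)) ->
  (forall J, J \subset H -> P (orb abG H J)) -> forall x, P x.
Proof.
move=> P0 PB Porb.
have PN x : P x -> P (- x) by move=> Px; rewrite -sub0r; apply: PB.
have PD x y : P x -> P y -> P (x + y).
  by move=> Px Py; rewrite -[y]opprK; apply: PB => //; apply: PN.
have Pn x n : P x -> P (x *+ n).
  by move=> Px; elim: n => [|n IH]; rewrite ?mulr0n // mulrS; apply: PD.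
move=> x; rewrite [x]orb_sum; apply: big_ind => // J _.
have PJ := Porb _ (valP J).
by case: ((x : {ffun _ -> int}) J) => n; [apply: Pn | apply/PN/Pn].
Qed.

(** The element at L of the embedding of [A(H)] with the a-twisted
    restrictions into a product of copies of the integers: the class of H/J
    has the usual mark |H : J| at L <= J, multiplied by r_L / r_J. For a = 1
    this is the ordinary mark. *)
Definition tmark a H L (x : A H) : int :=
  linext (fun J : subgroup_of H => if L \subset val J
    then #|H : val J|%:Z * twist_ratio a (val J) L else 0) x.

HB.instance Definition _ a H L := GRing.isZmodMorphism.Build (A H) int
  (@tmark a H L) (linext_is_zmod_morphism _).

Lemma tmark_orb a H L J : J \subset H ->
  tmark a L (orb abG H J) =
    if L \subset J then #|H : J|%:Z * twist_ratio a J L else 0.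
Proof.
move=> sJH; exact: (linextE abG (fun J => if L \subset J
    then #|H : J|%:Z * twist_ratio a J L else 0) sJH).
Qed.

Lemma twist_ratio1 J L : twist_ratio (twist_one gT) J L = 1.
Proof. by rewrite /twist_ratio big1 // => K _; rewrite ffunE. Qed.

Lemma twist_ratio_mul a b J L :
  twist_ratio (twist_mul a b) J L = twist_ratio a J L * twist_ratio b J L.
Proof. by rewrite /twist_ratio -big_split; apply: eq_bigr => K _; rewrite ffunE. Qed.

Lemma tmark1 H L (x : A H) : tmark (twist_one gT) L x = mark L x.
Proof.
rewrite /tmark /mark /linext; apply: eq_bigr => J _.
by rewrite twist_ratio1 mulr1.
Qed.

(** The matrix of the twisted marks is triangular with the indices |H : J| on
    the diagonal, since ratio(J, J) = 1. *)
Lemma tmark_leading a H (J : subgroup_of H) (x : A H) :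
    (forall K : subgroup_of H, (#|val J| < #|val K|)%N ->
      (x : {ffun _ -> int}) K = 0) ->
  tmark a (val J) x = #|H : val J|%:Z * (x : {ffun _ -> int}) J.
Proof.
move=> x0; rewrite /tmark /linext (bigD1 J) //= subxx twist_ratio_id mulr1.
rewrite mulrzz big1 ?addr0 // => K neKJ.
case: ifP => sJK; last by rewrite mul0rz.
rewrite x0 ?mulr0z // ltn_neqAle subset_leq_card // andbT.
apply: contra neKJ => /eqP eJK; apply/eqP/val_inj/val_inj/eqP.
by rewrite eq_sym eqEcard sJK eJK leqnn.
Qed.

Lemma tmark_coef0 a H m (x : A H) :
    (forall K, K \subset H -> (m < #|K|)%N -> tmark a K x = 0) ->
  forall K : subgroup_of H, (m < #|val K|)%N -> (x : {ffun _ -> int}) K = 0.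
Proof.
move=> x0 K ltmK; apply/eqP/negPn/negP => nz.
case: (@arg_maxnP _ K (fun K : subgroup_of H =>
    (x : {ffun _ -> int}) K != 0) (fun K : subgroup_of H => #|val K|) nz).
move=> L nzL maxL.
have := x0 (val L) (valP L) (leq_trans ltmK (maxL _ nz)).
rewrite tmark_leading => [/eqP|M ltLM]; last first.
  by apply/eqP/negPn/negP => /maxL /=; rewrite leqNgt ltLM.
by rewrite mulf_eq0 (negPf nzL) orbF eqz_nat eqn0Ngt indexg_gt0.
Qed.

(** A necessary condition for a family of integers to be a family of twisted
    marks; it is what detects the class of a_J modulo |G : J| in the proof of
    injectivity. *)
Lemma tmark_top a H J (x : A H) : J \subset H ->
    (forall K, K \subset H -> (#|J| < #|K|)%N -> tmark a K x = 0) ->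
  (#|H : J|%:Z %| tmark a J x)%Z.
Proof.
move=> sJH /tmark_coef0 x0.
by rewrite -[J]/(val (Sub J sJH : subgroup_of H)) tmark_leading ?dvdz_mulr.
Qed.

Lemma tmark_inj a H (x y : A H) :
  (forall L, L \subset H -> tmark a L x = tmark a L y) -> x = y.
Proof.
move=> eqxy; apply/eqP; rewrite -subr_eq0; apply/eqP/ffunP => J.
rewrite [RHS]ffunE (@tmark_coef0 a H 0) ?cardG_gt0 // => L sLH _.
by rewrite raddfB /= eqxy ?subrr.
Qed.

(** In twisted marks, restriction is restriction of families: this is what the
    factors r_{J n K} / r_J in the twisted restrictions achieve. *)
Lemma tmark_res a H K L (x : A H) : L \subset K -> K \subset H ->
  tmark a L (twisted_res a K x) = tmark a L x.
Proof.
move=> sLK sKH.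
apply: (@orb_ext _ _ _ _ (@tmark a K L \o @twisted_res _ abG a H K)
  (@tmark a H L)) => J sJH /=.
rewrite twisted_res_orb // raddfMz /= !tmark_orb ?subsetIr // subsetI sLK andbT.
case: ifP => sLJ; last by rewrite mul0rz.
have -> : #|H : J| = (#|H : J <*> K| * #|K : J :&: K|)%N.
  by rewrite [J <*> K]joingC [J :&: K]setIC index_join.
rewrite -(@twist_ratioM _ a J (J :&: K)%G L) ?subsetIl ?subsetI ?sLJ //.
rewrite mulrzz PoszM /=; ring.
Qed.

Lemma tmark_tr a H K L (x : A K) : K \subset H ->
  tmark a L (twisted_tr H x) =
    if L \subset K then #|H : K|%:Z * tmark a L x else 0.
Proof.
move=> sKH.
transitivity ((if L \subset K then #|H : K|%:Z else 0) * tmark a L x); last first.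
  by case: ifP => // _; rewrite mul0r.
apply: (@orb_ext _ _ _ _ (@tmark a H L \o @twisted_tr _ abG K H)
  (GRing.mull_fun (if L \subset K then #|H : K|%:Z else 0) (@tmark a K L))) => J sJK /=.
rewrite /GRing.mull_fun twisted_tr_orb // !tmark_orb ?(subset_trans sJK) //.
case: ifP => sLJ; last by rewrite mulr0.
rewrite (subset_trans sLJ sJK) mulrA -PoszM; congr (_%:Z * _).
by rewrite Lagrange_index.
Qed.

(** The families of integers, indexed by the subgroups of H, that are the
    twisted marks of an element of [A(H)]; values at other subgroups are
    ignored. Isomorphism questions about twisted Burnside functors become
    comparisons of these lattices. *)
Definition lattice a H f : Prop :=
  exists x : A H, forall L, L \subset H -> tmark a L x = f L.

Lemma lattice_ext a H f g : (forall L, L \subset H -> f L = g L) ->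
  lattice a H f -> lattice a H g.
Proof. by move=> fg [x xf]; exists x => L sLH; rewrite xf ?fg. Qed.

Lemma lattice_tmark a H (x : A H) : lattice a H (fun L => tmark a L x).
Proof. by exists x. Qed.

Lemma lattice0 a H : lattice a H (fun=> 0).
Proof. by exists 0 => L _; rewrite raddf0. Qed.

Lemma latticeB a H f g : lattice a H f -> lattice a H g ->
  lattice a H (fun L => f L - g L).
Proof.
by move=> [x xf] [y yg]; exists (x - y) => L sLH; rewrite raddfB /= xf ?yg.
Qed.

Lemma lattice_gen a b H (e : {group gT} -> int) :
    (forall J, J \subset H ->
      lattice b H (fun L => e L * tmark a L (orb abG H J))) ->
  forall f, lattice a H f -> lattice b H (fun L => e L * f L).
Proof.
move=> gen f [x xf].
apply: (@lattice_ext _ _ (fun L => e L * tmark a L x)).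
  by move=> L sLH; rewrite xf.
elim/burnside_ind: x {f xf} => [|x y lx ly|//].
  by apply: lattice_ext (lattice0 _ _) => L _; rewrite raddf0 mulr0.
by apply: lattice_ext (latticeB lx ly) => L _ /=; rewrite raddfB /= mulrBr.
Qed.

(** On classes, v_J v_K = ratio_a(J, J n K) ratio_b(K, J n K) |H : JK| v_{J n
    K}: the orbit decomposition of the product together with the
    multiplicativity of the ratios. *)
Lemma lattice_mul a b H f g : lattice a H f -> lattice b H g ->
  lattice (twist_mul a b) H (fun L => f L * g L).
Proof.
move=> lf; apply: lattice_gen => K sKH.
apply: (@lattice_ext _ _ (fun L => tmark b L (orb abG H K) * f L)) => [L _|].
  by rewrite mulrC.
apply: lattice_gen lf => J sJH.
have sIH : J :&: K \subset H by apply: subset_trans sJH; apply: subsetIl.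
exists (orb abG H (J :&: K)%G *~ (#|H : J <*> K|%:Z *
  (twist_ratio a J (J :&: K)%G * twist_ratio b K (J :&: K)%G))) => L sLH.
rewrite raddfMz /= !tmark_orb //= subsetI.
case: ifP => [/andP[sLJ sLK]|]; last first.
  rewrite mul0rz; case: ifP => [sLK|_ _]; last by rewrite mul0r.
  by rewrite andbT => ->; rewrite mulr0.
rewrite sLJ sLK twist_ratio_mul mulrzz.
rewrite -(@twist_ratioM _ a J (J :&: K)%G L) ?subsetIl ?subsetI ?sLJ //.
rewrite -(@twist_ratioM _ b K (J :&: K)%G L) ?subsetIr ?subsetI ?sLJ //.
transitivity ((#|H : J <*> K| * #|H : J :&: K|)%N%:Z *
  (twist_ratio a (J :&: K)%G L * twist_ratio b (J :&: K)%G L *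
  (twist_ratio a J (J :&: K)%G * twist_ratio b K (J :&: K)%G))).
  by rewrite PoszM /=; ring.
by rewrite index_meet // PoszM /=; ring.
Qed.

Definition twist_set a H (k : int) : twist gT :=
  [ffun K => if K == H then k else a K].

(** The ratio at (J, L) only involves the a_K with K >= L not containing J. *)
Lemma twist_ratio_set a H k J L : J \subset H ->
  twist_ratio (twist_set a H k) J L = twist_ratio a J L.
Proof.
move=> sJH; apply: eq_bigr => K /andP[_ nsJK]; rewrite ffunE.
by case: eqP => // eKH; rewrite eKH sJH in nsJK.
Qed.

Lemma twist_ratio_set_r a H k J L : ~~ (L \subset H) ->
  twist_ratio (twist_set a H k) J L = twist_ratio a J L.
Proof.
move=> nsLH; apply: eq_bigr => K /andP[sLK _]; rewrite ffunE.
by case: eqP => // eKH; rewrite -eKH sLK in nsLH.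
Qed.

Lemma twist_ratio_set1 a H k J L : L \subset H -> ~~ (J \subset H) ->
  twist_ratio (twist_set a H k) J L = k * twist_ratio (twist_set a H 1) J L.
Proof.
move=> sLH nsJH; rewrite /twist_ratio (bigD1 H) ?sLH //= ffunE eqxx.
congr (_ * _); rewrite [RHS](bigD1 H) ?sLH //= ffunE eqxx mul1r.
by apply: eq_bigr => K /andP[_ /negPf neKH]; rewrite !ffunE neKH.
Qed.

(** Only the v_J with J not inside H change, and replacing a_H = k by l moves
    v_J by (k - l) |S : J| times a multiple of the family v_{J n H} / |S : J n
    H|. As |G : H| = |J : J n H| |G : JH|, a difference k - l divisible by |G
    : H| makes this an integral multiple of v_{J n H}. *)
Lemma lattice_set a S H (k l : int) f : (#|G : H|%:Z %| k - l)%Z ->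
  lattice (twist_set a H k) S f -> lattice (twist_set a H l) S f.
Proof.
case/dvdzP => q kl lf; apply: (@lattice_ext _ _ (fun L => 1 * f L)) => [L _|].
  by rewrite mul1r.
apply: lattice_gen lf => J sJS.
have [sJH|nsJH] := boolP (J \subset H).
  exists (orb abG S J) => L _; rewrite !tmark_orb // mul1r.
  by rewrite !twist_ratio_set.
have sIS : J :&: H \subset S by apply: subset_trans sJS; apply: subsetIl.
exists (orb abG S J + orb abG S (J :&: H)%G *~
  (q * twist_ratio (twist_set a H 1) J (J :&: H)%G * #|G : J <*> H|%:Z)).
move=> L sLS; rewrite raddfD /= raddfMz /= mul1r !tmark_orb //= subsetI.
case: ifP => sLJ /=; last by rewrite mul0rz addr0.
case: ifP => sLH; last by rewrite mul0rz addr0 !twist_ratio_set_r ?sLH.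
rewrite mulrzz (@twist_ratio_set1 a H k) // (@twist_ratio_set1 a H l) //.
rewrite [twist_ratio _ (J :&: H)%G L]twist_ratio_set ?subsetIr //.
rewrite -(@twist_ratio_set a H 1 (J :&: H)%G L (subsetIr J H)).
rewrite -(@twist_ratioM _ (twist_set a H 1) J (J :&: H)%G L)
  ?subsetIl ?subsetI ?sLJ //.
have e : (#|S : J :&: H| * #|G : J <*> H| = #|S : J| * #|G : H|)%N.
  rewrite -(index_join abG (subsetT J) (subsetT H)).
  rewrite -(Lagrange_index sJS (subsetIl J H)) /=.
  by rewrite -!mulnA; congr (_ * _)%N; rewrite mulnC.
have -> : k = l + q * #|G : H|%:Z by rewrite -kl; ring.
set u := twist_ratio _ _ _; set v := twist_ratio _ _ _.
transitivity (#|S : J|%:Z * (l * (v * u)) + (#|S : J :&: H| * #|G : J <*> H|)%N%:Z * (q * u * v)).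
  by rewrite PoszM /=; ring.
by rewrite e PoszM; ring.
Qed.

(** The residue of a_K modulo |G : K| determines the lattice: the entries of
    the twist are changed one after the other. *)
Lemma lattice_congr a b S f :
    (forall K, (#|G : K|%:Z %| a K - b K)%Z) ->
  lattice a S f -> lattice b S f.
Proof.
move=> ab lf.
(* m s takes its values from b on s and from a elsewhere. *)
pose m (s : seq {group gT}) : twist gT := [ffun K => if K \in s then b K else a K].
have step s : lattice (m s) S f.
  elim: s => [|H s IH].
    by rewrite (_ : m [::] = a) //; apply/ffunP => K; rewrite ffunE in_nil.
  have -> : m (H :: s) = twist_set (m s) H (b H).
    by apply/ffunP => K; rewrite !ffunE inE; case: eqP => // ->.
  apply: (@lattice_set _ _ _ (m s H)).
    by rewrite ffunE; case: ifP => _; rewrite // subrr dvdz0.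
  rewrite (_ : twist_set _ _ _ = m s) //.
  by apply/ffunP => K; rewrite ffunE; case: eqP => // ->.
rewrite (_ : b = m (enum {group gT})) //.
by apply/ffunP => K; rewrite ffunE mem_enum.
Qed.

(** Signs in the twist amount to changing the signs of the coordinates. *)
Lemma lattice_sign a (s : twist gT) S f :
  lattice a S f -> lattice (twist_mul s a) S (fun L => twist_r s L * f L).
Proof.
apply: lattice_gen => J sJS.
exists (orb abG S J *~ twist_r s J) => L sLS.
rewrite raddfMz /= !tmark_orb //; case: ifP => sLJ; last first.
  by rewrite mulr0 mul0rz.
rewrite twist_ratio_mul (twist_ratioP s sLJ) mulrzz.
by ring.
Qed.

End TwistedMarks.

(** * Morphisms and pairings of Mackey functors *)

Section MackeyMorphisms.
Variables (gT : finGroupType).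
Implicit Types (H K L : {group gT}) (M N P : mackey gT).

(** Builds a morphism from bare functions, which keeps the proofs below free
    of bundled additive maps. *)
Lemma mackey_homP M N (f : forall H, M H -> N H) :
    (forall H, zmod_morphism (f H)) ->
    (forall H K x, K \subset H -> f K (mres M H K x) = mres N H K (f H x)) ->
    (forall H K x, K \subset H -> f H (mtr M K H x) = mtr N K H (f K x)) ->
    (forall g H x, f H (Defs.mact M g H x) = Defs.mact N g H (f H x)) ->
  exists F : mackey_hom M N, forall H, F H =1 f H.
Proof.
move=> fB fres ftr fact.
pose F H : {additive M H -> N H} :=
  HB.pack (f H) (GRing.isZmodMorphism.Build _ _ (f H) (fB H)).
by exists (@MackeyHom gT M N F fres ftr fact).
Qed.

Lemma mackey_iso_trans M N P : mackey_iso M N -> mackey_iso N P -> mackey_iso M P.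
Proof.
move=> [f [g fg]] [f' [g' fg']].
have [F FE] : exists F : mackey_hom M P, forall H, F H =1 f' H \o f H.
  apply: mackey_homP => [H x y|H K x sKH|H K x sKH|k H x] /=.
  - by rewrite !raddfB.
  - by rewrite !mhom_res.
  - by rewrite !mhom_tr.
  - by rewrite !mhom_act.
have [E EE] : exists E : mackey_hom P M, forall H, E H =1 g H \o g' H.
  apply: mackey_homP => [H x y|H K x sKH|H K x sKH|k H x] /=.
  - by rewrite !raddfB.
  - by rewrite !mhom_res.
  - by rewrite !mhom_tr.
  - by rewrite !mhom_act.
exists F, E => H; have [c1 c2] := fg H; have [c3 c4] := fg' H.
by split=> x; rewrite FE EE /= (c3, c2) (c1, c4).
Qed.

Section Pairings.
Variables (M N P : mackey gT) (t : forall H, M H -> N H -> P H).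
Hypothesis pt : mackey_pairing (@t).

Lemma pairingBl H (x x' : M H) (y : N H) : t (x - x') y = t x y - t x' y.
Proof. by apply/eqP; rewrite eq_sym subr_eq -(pairingDl pt) subrK. Qed.

Lemma pairingBr H (x : M H) (y y' : N H) : t x (y - y') = t x y - t x y'.
Proof. by apply/eqP; rewrite eq_sym subr_eq -(pairingDr pt) subrK. Qed.

Lemma pairing0l H (y : N H) : t 0 y = 0.
Proof. by have := pairingBl (0 : M H) 0 y; rewrite !subrr. Qed.

Lemma pairing0r H (x : M H) : t x 0 = 0.
Proof. by have := pairingBr x (0 : N H) 0; rewrite !subrr. Qed.

Lemma pairing_sumr H (x : M H) n (y : 'I_n -> N H) :
  t x (\sum_i y i) = \sum_i t x (y i).
Proof.
by apply: (big_morph (t x)) => [y1 y2|]; rewrite ?(pairingDr pt) ?pairing0r.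
Qed.

End Pairings.

End MackeyMorphisms.

(** * Twisted Burnside Mackey functors are invertible Kuenneth objects *)

Section TwistedProducts.
Variables (gT : finGroupType) (abG : abelian [set: gT]).
Implicit Types (H J K L : {group gT}) (a b c : twist gT)
  (f g : {group gT} -> int).
Notation G := [set: gT]%G.
Notation A := (burnside abG).
Notation one := (twist_one gT).
Notation MA := (twisted_mackey abG).

(** The element with prescribed marks, unique by [tmark_inj]; a default value
    is returned outside of the lattice. Choosing it gives functions whose
    identities can all be checked on marks. *)
Definition untmark a H f : A H :=
  if pselect (lattice abG a H f) is left h then sval (cid h) else 0.

Lemma tmark_untmark a H f L : lattice abG a H f -> L \subset H ->
  tmark a L (untmark a H f) = f L.
Proof. by rewrite /untmark; case: pselect => // h _; apply: (svalP (cid h)). Qed.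

(** A sign vector that exchanges the lattices at every level commutes with
    restrictions and transfers, which only select or rescale coordinates. *)
Lemma lattice_iso a b (e : {group gT} -> int) : (forall L, e L * e L = 1) ->
    (forall S f, lattice abG a S f -> lattice abG b S (fun L => e L * f L)) ->
    (forall S f, lattice abG b S f -> lattice abG a S (fun L => e L * f L)) ->
  mackey_iso (MA a) (MA b).
Proof.
pose F a b H (x : A H) : A H := untmark b H (fun L => e L * tmark a L x).
move=> e2 ab ba.
suff hom u v : (forall S f, lattice abG u S f -> lattice abG v S (fun L => e L * f L)) ->
    exists E : mackey_hom (MA u) (MA v),
      forall H (x : A H) L, L \subset H -> tmark v L (E H x) = e L * tmark u L x.
  have [f fE] := hom a b ab; have [g gE] := hom b a ba.
  exists f, g => H; split=> x.
    by apply: (@tmark_inj _ _ a) => L sLH; rewrite gE // fE // mulrA e2 mul1r.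
  by apply: (@tmark_inj _ _ b) => L sLH; rewrite fE // gE // mulrA e2 mul1r.
move=> uv.
have FE H (x : A H) L : L \subset H -> tmark v L (F u v H x) = e L * tmark u L x.
  by apply: tmark_untmark; apply/uv/lattice_tmark.
have [E EE] : exists E : mackey_hom (MA u) (MA v), forall H, E H =1 F u v H.
  apply: (@mackey_homP _ (MA u) (MA v)) => [H x y|H K x sKH|H K x sKH|k H x] //=.
  - by apply: (@tmark_inj _ _ v) => L sLH; rewrite raddfB /= !FE // raddfB /= mulrBr.
  - apply: (@tmark_inj _ _ v) => L sLK; have sLH := subset_trans sLK sKH.
    by rewrite tmark_res // !FE // tmark_res.
  - apply: (@tmark_inj _ _ v) => L sLH; rewrite tmark_tr // FE // tmark_tr //.
    by case: ifP => sLK; rewrite ?mulr0 // FE // mulrCA.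
by exists E => H x L sLH; rewrite EE FE.
Qed.

(** The congruences under which multiplication of marks maps the lattices of a
    and b into the lattice of c. *)
Definition compat a b c := forall K, (#|G : K|%:Z %| a K * b K - c K)%Z.

Lemma compat1l a : compat one a a.
Proof. by move=> K; rewrite ffunE mul1r subrr dvdz0. Qed.

Lemma compatC a b c : compat a b c -> compat b a c.
Proof. by move=> h K; rewrite mulrC. Qed.

Lemma lattice_compat a b c H f g : compat a b c ->
  lattice abG a H f -> lattice abG b H g -> lattice abG c H (fun L => f L * g L).
Proof.
move=> abc lf lg; apply: (@lattice_congr _ _ (twist_mul a b)).
  by move=> K; rewrite ffunE.
exact: lattice_mul.
Qed.

Definition tmul a b c H (x y : A H) : A H :=
  untmark c H (fun L => tmark a L x * tmark b L y).

Lemma tmark_tmul a b c H (x y : A H) L : compat a b c -> L \subset H ->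
  tmark c L (tmul a b c x y) = tmark a L x * tmark b L y.
Proof.
by move=> abc; apply: tmark_untmark; apply: (lattice_compat abc);
  apply: lattice_tmark.
Qed.

Lemma tmul_pairing a b c : compat a b c ->
  @mackey_pairing gT (MA a) (MA b) (MA c) (@tmul a b c).
Proof.
move=> abc; split=> /=.
- move=> H x x' y; apply: (@tmark_inj _ _ c) => L sLH.
  by rewrite raddfD /= !tmark_tmul // raddfD mulrDl.
- move=> H x y y'; apply: (@tmark_inj _ _ c) => L sLH.
  by rewrite raddfD /= !tmark_tmul // raddfD mulrDr.
- move=> H K x y sKH; apply: (@tmark_inj _ _ c) => L sLK.
  have sLH := subset_trans sLK sKH.
  by rewrite tmark_res // !tmark_tmul // !tmark_res.
- by [].
- move=> H K x y sKH; apply: (@tmark_inj _ _ c) => L sLH.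
  rewrite tmark_tmul // !tmark_tr //; case: ifP => sLK; last by rewrite mul0r.
  by rewrite tmark_tmul // tmark_res // mulrA.
- move=> H K x y sKH; apply: (@tmark_inj _ _ c) => L sLH.
  rewrite tmark_tmul // !tmark_tr //; case: ifP => sLK; last by rewrite mulr0.
  by rewrite tmark_tmul // tmark_res // mulrCA.
Qed.

(** Multiplying by the class of H/J is the restriction to J followed by the
    transfer, as it should be for a module over the Burnside functor. *)
Lemma tmul_orb a H J (x : A H) : J \subset H ->
  tmul one a a (orb abG H J) x = twisted_tr H (twisted_res a J x).
Proof.
move=> sJH; apply: (@tmark_inj _ _ a) => L sLH.
rewrite (tmark_tmul _ _ (compat1l a)) // tmark_orb // tmark_tr //.
by case: ifP => sLJ; rewrite ?mul0r // twist_ratio1 mulr1 tmark_res.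
Qed.

(** By Frobenius reciprocity: the class of H/J acts as the composite of a
    restriction and a transfer. *)
Lemma pairing_balanced a b (Q : mackey gT)
    (s : forall H, MA a H -> MA b H -> Q H) (ps : mackey_pairing s)
    H (c x y : A H) :
  s H (tmul one a a c x) y = s H x (tmul one b b c y).
Proof.
have pa := tmul_pairing (compat1l a); have pb := tmul_pairing (compat1l b).
elim/burnside_ind: c => [|c d IHc IHd|J sJH].
- by rewrite (pairing0l pa) (pairing0l pb) (pairing0l ps) (pairing0r ps).
- rewrite (pairingBl pa) (pairingBl pb) (pairingBl ps) (pairingBr ps).
  by rewrite IHc IHd.
rewrite !tmul_orb //.
by rewrite (pairing_trl ps _ y sJH) (pairing_trr ps x _ sJH).
Qed.

(** A decomposition of 1 as a sum of products, the integral form of the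
    statement that the lattices of a and b are inverse fractional ideals. *)
Definition dual_bases a b n (x y : 'I_n -> A G) :=
  forall L, \sum_i tmark a L (x i) * tmark b L (y i) = 1.

Lemma dual_basesC a b n (x y : 'I_n -> A G) :
  dual_bases a b x y -> dual_bases b a y x.
Proof. by move=> h L; rewrite -[RHS](h L); apply: eq_bigr => i _; rewrite mulrC. Qed.

Section InverseTwists.
Variables (a b : twist gT) (n : nat) (x y : 'I_n -> A G).
Hypotheses (ab1 : compat a b one) (xy1 : dual_bases a b x y).

Let xr i H : A H := twisted_res a H (x i).
Let yr i H : A H := twisted_res b H (y i).

Let xrE i H L : L \subset H -> tmark a L (xr i H) = tmark a L (x i).
Proof. by move=> sLH; rewrite tmark_res // subsetT. Qed.

Let yrE i H L : L \subset H -> tmark b L (yr i H) = tmark b L (y i).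
Proof. by move=> sLH; rewrite tmark_res // subsetT. Qed.

(** The maps m |-> (m y_i)_i and (u_i)_i |-> sum_i u_i x_i exhibit the functor
    as a retract of a finite copower of the unit. *)
Lemma twisted_kunneth : kunneth_mackey abG (MA a).
Proof.
pose C := mackey_copower (burnside_mackey abG) n.
pose ri H (m : A H) : {ffun 'I_n -> A H} := [ffun i => tmul a b one m (yr i H)].
pose rp H (u : {ffun 'I_n -> A H}) : A H := \sum_i tmul one a a (u i) (xr i H).
have pab := tmul_pairing ab1; have pa := tmul_pairing (compat1l a).
have riE H m i L : L \subset H ->
  tmark one L (ri H m i) = tmark a L m * tmark b L (y i).
  by move=> sLH; rewrite ffunE tmark_tmul // yrE.
have rpE H u L : L \subset H ->
  tmark a L (rp H u) = \sum_i tmark one L (u i) * tmark a L (x i).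
  move=> sLH; rewrite raddf_sum; apply: eq_bigr => i _ /=.
  by rewrite (tmark_tmul _ _ (compat1l a)) // xrE.
have [I IE] : exists I : mackey_hom (MA a) C, forall H, I H =1 ri H.
  apply: (@mackey_homP _ (MA a) C) => [H m m'|H K m sKH|H K m sKH|k H m] //.
  - by apply/ffunP => i; rewrite !ffunE (pairingBl pab).
  - apply/ffunP => i; apply: (@tmark_inj _ _ one) => L sLK.
    by rewrite riE // [in RHS]ffunE !tmark_res // riE // (subset_trans sLK).
  - apply/ffunP => i; apply: (@tmark_inj _ _ one) => L sLH.
    rewrite riE // [in RHS]ffunE !tmark_tr //.
    by case: ifP => sLK; rewrite ?mul0r // riE // mulrA.
  - by apply/ffunP => i; rewrite [in RHS]ffunE.
have [P PE] : exists P : mackey_hom C (MA a), forall H, P H =1 rp H.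
  apply: (@mackey_homP _ C (MA a)) => [H m m'|H K m sKH|H K m sKH|k H m] //.
  - rewrite /rp -sumrB; apply: eq_bigr => i _.
    by rewrite !ffunE (pairingBl pa).
  - apply: (@tmark_inj _ _ a) => L sLK; have sLH := subset_trans sLK sKH.
    rewrite tmark_res // !rpE //; apply: eq_bigr => i _.
    by rewrite ffunE tmark_res.
  - apply: (@tmark_inj _ _ a) => L sLH; rewrite tmark_tr // rpE //.
    case: ifP => sLK; last first.
      by rewrite big1 // => i _; rewrite ffunE tmark_tr // sLK mul0r.
    rewrite rpE // mulr_sumr; apply: eq_bigr => i _.
    by rewrite ffunE tmark_tr // sLK mulrA.
  - by congr (rp H _); apply/ffunP => i; rewrite ffunE.
exists n, I, P => H m; apply: (@tmark_inj _ _ a) => L sLH.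
rewrite PE IE rpE // -[RHS]mulr1 -(xy1 L) mulr_sumr.
by apply: eq_bigr => i _; rewrite riE // mulrAC mulrA.
Qed.

(** A pairing s with values in Q must factor through c |-> sum_i s(c x_i,
    y_i); this works because pairings are balanced over the Burnside functor.
    *)
Lemma twisted_box : mackey_box (MA a) (MA b) (burnside_mackey abG).
Proof.
exists (@tmul a b one); first exact: tmul_pairing.
move=> Q s ps.
have pa := tmul_pairing (compat1l a).
pose f H (c : A H) : Q H := \sum_i s H (tmul one a a c (xr i H)) (yr i H).
have fE H u v : f H (tmul a b one u v) = s H u v.
  transitivity (s H u (\sum_i tmul one b b (tmul a b one (xr i H) v) (yr i H))).
    rewrite (pairing_sumr ps); apply: eq_bigr => i _.
    rewrite -(pairing_balanced ps); congr (s H _ _).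
    apply: (@tmark_inj _ _ a) => L sLH; rewrite !(tmark_tmul _ _ (compat1l a)) //.
    by rewrite !tmark_tmul //; ring.
  congr (s H _ _); apply: (@tmark_inj _ _ b) => L sLH.
  rewrite raddf_sum /= -[RHS]mulr1 -(xy1 L) mulr_sumr; apply: eq_bigr => i _.
  by rewrite (tmark_tmul _ _ (compat1l b)) // tmark_tmul // xrE // yrE //; ring.
have [F FE] : exists F : mackey_hom (burnside_mackey abG) Q, forall H, F H =1 f H.
  apply: (@mackey_homP _ (burnside_mackey abG) Q) => [H m m'|H K m sKH|H K m sKH|k H m].
  - rewrite /f -sumrB; apply: eq_bigr => i _.
    by rewrite (pairingBl pa) (pairingBl ps).
  - rewrite /f raddf_sum; apply: eq_bigr => i _ /=.
    rewrite (pairing_res ps _ _ sKH) /= (pairing_res pa _ _ sKH) /=.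
    by rewrite /xr /yr !twisted_res_comp // subsetT.
  - rewrite /f raddf_sum; apply: eq_bigr => i _ /=.
    rewrite (pairing_trl pa _ _ sKH) (pairing_trl ps _ _ sKH) /=.
    by rewrite /xr /yr !twisted_res_comp // subsetT.
  - by rewrite /f raddf_sum; apply: eq_bigr => i _ /=; rewrite (pairing_act ps).
exists F => [H u v|F' F'E H c]; first by rewrite FE fE.
rewrite FE /f.
transitivity (F' H (\sum_i tmul a b one (tmul one a a c (xr i H)) (yr i H))).
  congr (F' H _); apply: (@tmark_inj _ _ one) => L sLH.
  rewrite raddf_sum /= -[LHS]mulr1 -(xy1 L) mulr_sumr; apply: eq_bigr => i _.
  by rewrite tmark_tmul // (tmark_tmul _ _ (compat1l a)) // xrE // yrE // mulrA.
by rewrite raddf_sum; apply: eq_bigr => i _ /=; rewrite F'E.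
Qed.

End InverseTwists.

(** The product v_J v_G equals ratio_b(G, J) times the class of G/J in the
    lattice of ab, and v_G v_J equals ratio_a(G, J) times it. When these
    factors are coprime, a Bezout relation puts every class, hence also 1,
    into the product of the two lattices. One of the two factors is always
    v_G, so that two summands are enough. *)
Lemma ex_dual_bases a b : compat a b one ->
    (forall J, coprimez (twist_ratio a G J) (twist_ratio b G J)) ->
  exists x y : 'I_2 -> A G, dual_bases a b x y.
Proof.
move=> ab1 cop.
have [w wE] : lattice abG (twist_mul a b) G (fun=> 1).
  apply: (@lattice_congr _ _ one) => [K|].
    by rewrite -opprB rpredN; have := ab1 K; rewrite !ffunE.
  exists (orb abG G G) => L _.
  by rewrite tmark_orb // subsetT indexgg twist_ratio1.
suff [x1 [x2 xE]] : exists x1 x2 : A G, forall L, tmark (twist_mul a b) L w =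
    tmark a L x1 * twist_ratio b G L + twist_ratio a G L * tmark b L x2.
  pose x i : A G := if i == ord0 :> 'I_2 then x1 else orb abG G G.
  pose y i : A G := if i == ord0 :> 'I_2 then orb abG G G else x2.
  exists x, y => L; rewrite !big_ord_recl big_ord0 /x /y /= addr0.
  by rewrite !tmark_orb // subsetT indexgg !mul1r -xE wE ?subsetT.
elim/burnside_ind: w {wE} => [|u v [u1 [u2 uE]] [v1 [v2 vE]]|J sJG].
- by exists 0, 0 => L; rewrite !raddf0 mul0r mulr0 addr0.
- by exists (u1 - v1), (u2 - v2) => L; rewrite !raddfB /= uE vE; ring.
have /coprimezP[[u v] /= uv] := cop J.
exists (orb abG G J *~ v), (orb abG G J *~ u) => L.
rewrite !raddfMz /= !tmark_orb //; case: ifP => sLJ; last first.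
  by rewrite !mul0rz mul0r mulr0 addr0.
rewrite twist_ratio_mul -(twist_ratioM a sJG sLJ) -(twist_ratioM b sJG sLJ).
rewrite !mulrzz -[LHS]mulr1 -uv; ring.
Qed.

End TwistedProducts.

(** * Isomorphisms and tensor products of modules *)

Section ModuleIsomorphisms.
Variable R : comNzRingType.
Implicit Types M N P Q : lmodType R.

Lemma linear_mapP M N (f : M -> N) : linear f ->
  exists F : {linear M -> N}, F =1 f.
Proof.
move=> lf.
pose F : {linear M -> N} := HB.pack f (GRing.isLinear.Build R M N _ f lf).
by exists F.
Qed.

Lemma module_iso_refl M : module_iso M M.
Proof.
have [F FE] : exists F : {linear M -> M}, F =1 id by apply: linear_mapP.
by exists F; exists F => x; rewrite !FE.
Qed.

Lemma module_iso_sym M N : module_iso M N -> module_iso N M.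
Proof.
case=> f [g fK gK].
have [F FE] : exists F : {linear N -> M}, F =1 g.
  apply: linear_mapP => k x y; apply: (can_inj fK).
  by rewrite gK linearP !gK.
by exists F; exists f => x; rewrite FE.
Qed.

Lemma module_iso_trans M N P : module_iso M N -> module_iso N P -> module_iso M P.
Proof.
move=> [f fb] [g gb].
have [F FE] : exists F : {linear M -> P}, F =1 g \o f.
  by apply: linear_mapP => k x y /=; rewrite !linearP.
by exists F; apply: eq_bij (bij_comp gb fb) _ _ => x; rewrite FE.
Qed.

Lemma module_iso_class M N : module_iso M N -> module_iso M = module_iso N.
Proof.
move=> iMN; apply: funext => P; apply: propext; split=> [|iNP].
  exact: module_iso_trans (module_iso_sym iMN).
exact: module_iso_trans iMN iNP.
Qed.

Lemma tensor_isor M N P P' : module_tensor M N P -> module_iso P P' ->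
  module_tensor M N P'.
Proof.
move=> [t [tl tr] tu] [g [h gK hK]].
have lh : linear h.
  by move=> k x y; apply: (can_inj gK); rewrite hK linearP !hK.
exists (fun x y => g (t x y)).
  by split=> [y|x] k u v; rewrite ?tl ?tr linearP.
move=> Q s bs; have [f fE fu] := tu Q s bs.
have [F FE] : exists F : {linear P' -> Q}, F =1 f \o h.
  by apply: linear_mapP => k x y /=; rewrite lh linearP.
exists F => [x y|F' F'E p]; first by rewrite FE /= gK fE.
have [E EE] : exists E : {linear P -> Q}, E =1 F' \o g.
  by apply: linear_mapP => k x y /=; rewrite !linearP.
rewrite FE /= -(fu E) => [|x y]; first by rewrite EE /= hK.
by rewrite EE /= F'E.
Qed.

Lemma tensor_isol M N M' N' P : module_tensor M N P ->
  module_iso M' M -> module_iso N' N -> module_tensor M' N' P.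
Proof.
move=> [t [tl tr] tu] [g [g' gK g'K]] [h [h' hK h'K]].
have lg : linear g'.
  by move=> k x y; apply: (can_inj gK); rewrite g'K linearP !g'K.
have lh : linear h'.
  by move=> k x y; apply: (can_inj hK); rewrite h'K linearP !h'K.
exists (fun x y => t (g x) (h y)).
  by split=> [y|x] k u v; rewrite linearP ?tl ?tr.
move=> Q s [sl sr].
have [|f fE fu] := tu Q (fun x y => s (g' x) (h' y)).
  by split=> [y|x] k u v; rewrite ?lg ?lh ?sl ?sr.
exists f => [x y|F' F'E p]; first by rewrite fE gK hK.
by apply: fu => x y; rewrite -F'E g'K h'K.
Qed.

Lemma tensor_unique M N P P' : module_tensor M N P -> module_tensor M N P' ->
  module_iso P P'.
Proof.
move=> [t bt tu] [t' bt' tu'].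
have [f fE _] := tu P' t' bt'; have [g gE _] := tu' P t bt.
exists f; exists g => p.
  have [u _ uu] := tu P t bt.
  have [E EE] : exists E : {linear P -> P}, E =1 g \o f.
    by apply: linear_mapP => k x y /=; rewrite !linearP.
  have [I IE] : exists I : {linear P -> P}, I =1 id by apply: linear_mapP.
  transitivity (E p); first by rewrite EE.
  transitivity (I p); last by rewrite IE.
  by rewrite (uu E) ?(uu I) // => x y; rewrite ?IE // EE /= fE gE.
have [u _ uu] := tu' P' t' bt'.
have [E EE] : exists E : {linear P' -> P'}, E =1 f \o g.
  by apply: linear_mapP => k x y /=; rewrite !linearP.
have [I IE] : exists I : {linear P' -> P'}, I =1 id by apply: linear_mapP.
transitivity (E p); first by rewrite EE.
transitivity (I p); last by rewrite IE.
by rewrite (uu E) ?(uu I) // => x y; rewrite ?IE // EE /= gE fE.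
Qed.

End ModuleIsomorphisms.

(** * Modules over the Burnside ring embedded by marks *)

Section MarkedModules.
Variables (gT : finGroupType) (abG : abelian [set: gT]).
Implicit Types (H J K L : {group gT}).
Notation G := [set: gT]%G.
Notation AG := (burnside abG G).
Implicit Types M N P : lmodType AG.

(** An injective additive map to families of integers on which the Burnside
    ring acts through its marks: a torsion-free module of rank at most one at
    each prime ideal given by a mark, with chosen coordinates. *)
Record marking M (c : M -> {group gT} -> int) : Prop := Marking {
  markingB : forall x y L, c (x - y) L = c x L - c y L;
  markingZ : forall u x L, c (u *: x) L = mark L u * c x L;
  marking_inj : forall x y, (forall L, c x L = c y L) -> x = y
}.

Section MarkingTheory.
Variables (M : lmodType AG) (c : M -> {group gT} -> int).
Hypothesis mc : marking c.

Lemma marking0 L : c 0 L = 0.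
Proof. by rewrite -(subrr (0 : M)) (markingB mc) subrr. Qed.

Lemma markingD x y L : c (x + y) L = c x L + c y L.
Proof.
by rewrite -{1}[y]opprK (markingB mc) -sub0r (markingB mc) marking0 sub0r opprK.
Qed.

Lemma marking_sum (I : finType) (x : I -> M) L : c (\sum_i x i) L = \sum_i c (x i) L.
Proof.
apply: (big_morph (c^~ L)) => [u v|]; [exact: markingD | exact: marking0].
Qed.

Lemma markingMz x (k : int) L : c (x *~ k) L = c x L * k.
Proof.
have cB : zmod_morphism (c^~ L) by move=> u v; apply: markingB.
pose F : {additive M -> int} := HB.pack (c^~ L) (GRing.isZmodMorphism.Build _ _ _ cB).
by rewrite -mulrzz; apply: (raddfMz F).
Qed.

End MarkingTheory.

Lemma mark_mulr L (u v : AG) : mark L (u * v) = mark L u * mark L v.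
Proof. exact: mark_mul. Qed.

Lemma mark_one L : mark L (1 : AG) = 1.
Proof. by rewrite mark_orb // subsetT indexgg. Qed.

Lemma marking_regular : @marking AG^o (fun x L => mark L (x : AG)).
Proof.
split=> [x y L|u x L|x y e]; first exact: raddfB.
  exact: mark_mulr.
by apply: (@mark_inj _ abG G) => L _; apply: e.
Qed.

Lemma marked_linear M N c d :
    @marking M c -> @marking N d ->
    (forall x, exists y, forall L, d y L = c x L) ->
  exists F : {linear M -> N}, forall x L, d (F x) L = c x L.
Proof.
move=> mc md /choice[f fE].
have [F FE] : exists F : {linear M -> N}, F =1 f.
  apply: linear_mapP => k x y; apply: (marking_inj md) => L.
  by rewrite (markingD md) (markingZ md) !fE (markingD mc) (markingZ mc).
by exists F => x L; rewrite FE.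
Qed.

Lemma marked_iso M N c d :
    @marking M c -> @marking N d ->
    (forall x, exists y, forall L, d y L = c x L) ->
    (forall y, exists x, forall L, c x L = d y L) ->
  module_iso M N.
Proof.
move=> mc md cd dc.
have [F FE] := marked_linear mc md cd; have [E EE] := marked_linear md mc dc.
exists F; exists E => x.
  by apply: (marking_inj mc) => L; rewrite EE FE.
by apply: (marking_inj md) => L; rewrite FE EE.
Qed.

Section InverseMarkings.
Variables (M M' : lmodType AG) (c : M -> {group gT} -> int)
  (c' : M' -> {group gT} -> int) (n : nat) (x : 'I_n -> M) (x' : 'I_n -> M').
Hypothesis mc : marking c.
Hypothesis cc' : forall u v, exists w : AG, forall L, mark L w = c u L * c' v L.
Hypothesis dual : forall L, \sum_i c (x i) L * c' (x' i) L = 1.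

Let pair u v : AG := sval (cid (cc' u v)).
Let pairE u v L : mark L (pair u v) = c u L * c' v L.
Proof. exact: (svalP (cid (cc' u v))). Qed.

(** The module analogue of [twisted_kunneth]: a dual basis makes M a direct
    summand of a free module. *)
Lemma marked_kunneth : kunneth_module M.
Proof.
have [I IE] : exists I : {linear M -> {ffun 'I_n -> AG^o}},
    forall u, I u = [ffun i => pair u (x' i)].
  apply: linear_mapP => k u v; apply/ffunP => i; rewrite !ffunE.
  apply: (marking_inj marking_regular) => L.
  rewrite (markingD marking_regular) (markingZ marking_regular) !pairE.
  by rewrite (markingD mc) (markingZ mc); ring.
have [P PE] : exists P : {linear {ffun 'I_n -> AG^o} -> M},
    forall u, P u = \sum_i (u i : AG) *: x i.
  apply: linear_mapP => k u v; rewrite scaler_sumr -big_split /=.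
  apply: eq_bigr => i _; rewrite !ffunE scalerDl scalerA //.
exists n, I, P => u; apply: (marking_inj mc) => L.
rewrite PE IE (marking_sum mc) -[RHS]mulr1 -(dual L) mulr_sumr.
by apply: eq_bigr => i _; rewrite (markingZ mc) ffunE pairE; ring.
Qed.

(** Every w in P is the sum of the x_i (x'_i w), with x'_i w in N; so a
    bilinear map s must factor through w |-> sum_i s(x_i, x'_i w). *)
Lemma marked_tensor N P d p : @marking N d -> @marking P p ->
    (forall u v, exists w, forall L, p w L = c u L * d v L) ->
    (forall u w, exists v, forall L, d v L = c' u L * p w L) ->
  module_tensor M N P.
Proof.
move=> md mp cd c'p.
pose t u v := sval (cid (cd u v)).
have tE u v L : p (t u v) L = c u L * d v L by exact: (svalP (cid (cd u v))).
pose q u w := sval (cid (c'p u w)).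
have qE u w L : d (q u w) L = c' u L * p w L by exact: (svalP (cid (c'p u w))).
have bt : bilinear_map t.
  split=> [v|u] k u1 u2; apply: (marking_inj mp) => L;
  rewrite (markingD mp) (markingZ mp) !tE ?(markingD mc) ?(markingZ mc)
    ?(markingD md) ?(markingZ md); ring.
exists t => // Q s [sl sr].
have decomp w : w = \sum_i t (x i) (q (x' i) w).
  apply: (marking_inj mp) => L; rewrite (marking_sum mp) -[LHS]mulr1 -(dual L).
  by rewrite mulr_sumr; apply: eq_bigr => i _; rewrite tE qE; ring.
have [F FE] : exists F : {linear P -> Q},
    forall w, F w = \sum_i s (x i) (q (x' i) w).
  apply: linear_mapP => k w w'; rewrite scaler_sumr -big_split /=.
  apply: eq_bigr => i _; rewrite -sr; congr (s _ _).
  apply: (marking_inj md) => L.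
  by rewrite (markingD md) (markingZ md) !qE (markingD mp) (markingZ mp); ring.
exists F => [u v|F' F'E w]; last first.
  by rewrite FE [in LHS](decomp w) raddf_sum; apply: eq_bigr => i _ /=.
rewrite FE.
have sZl k u' v' : s (k *: u') v' = k *: s u' v'.
  have [F1 F1E] := linear_mapP (sl v'); by rewrite -!F1E linearZ.
have [F2 F2E] := linear_mapP (sr u).
have sZr k v' : s u (k *: v') = k *: s u v' by rewrite -!F2E linearZ.
transitivity (\sum_i s (pair u (x' i) *: x i) v).
  apply: eq_bigr => i _; rewrite sZl.
  have [F3 F3E] := linear_mapP (sr (x i)); rewrite -!F3E -linearZ; congr (F3 _).
  by apply: (marking_inj md) => L; rewrite qE tE (markingZ md) pairE; ring.
have [F4 F4E] := linear_mapP (sl v).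
transitivity (F4 (\sum_i pair u (x' i) *: x i)).
  by rewrite raddf_sum; apply: eq_bigr => i _ /=; rewrite F4E.
rewrite F4E; congr (s _ _); apply: (marking_inj mc) => L.
rewrite (marking_sum mc) -[RHS]mulr1 -(dual L) mulr_sumr.
by apply: eq_bigr => i _; rewrite (markingZ mc) pairE; ring.
Qed.

End InverseMarkings.

(** The action of the Burnside ring is defined by restrictions and transfers.
    *)
Lemma ev_iso (M N : mackey gT) : mackey_iso M N -> module_iso (ev abG M) (ev abG N).
Proof.
move=> [f [g fg]]; have [fK gK] := fg G.
have [F FE] : exists F : {linear ev abG M -> ev abG N}, F =1 f G.
  apply: linear_mapP => k x y; rewrite raddfD; congr (_ + _).
  rewrite raddf_sum; apply: eq_bigr => J _; rewrite raddfMz /=.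
  by rewrite mhom_tr ?subsetT // mhom_res ?subsetT.
by exists F; exists (g G) => x; rewrite FE.
Qed.

Lemma twisted_marking a : @marking (twisted_module abG a) (fun x L => tmark a L (x : AG)).
Proof.
split=> [x y L|u x L|x y e]; first exact: raddfB.
  rewrite -tmark1 -(tmark_tmul _ _ (compat1l a)) ?subsetT //.
  congr (tmark a L _).
  have pa := tmul_pairing abG (compat1l a).
  elim/burnside_ind: u => [|u v IHu IHv|J sJG].
  - by rewrite scale0r (pairing0l pa).
  - by rewrite scalerBl IHu IHv (pairingBl pa).
  rewrite tmul_orb //.
  exact: (linextE abG (fun J => mtr (twisted_mackey abG a) J G (mres (twisted_mackey abG a) G J x)) sJG).
by apply: (@tmark_inj _ abG a) => L _; apply: e.
Qed.

End MarkedModules.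

(** * Residues and units modulo n *)

Section IntegerResidues.

Lemma coprimez_by_primes (x y : int) :
  (forall p, prime p -> (p%:Z %| x)%Z -> ~ (p%:Z %| y)%Z) -> coprimez x y.
Proof.
move=> xy; rewrite coprimezE; apply/eqP; set d := gcdn _ _.
have dvd p : (p %| d)%N -> (p%:Z %| x)%Z /\ (p%:Z %| y)%Z.
  by rewrite dvdn_gcd !dvdzE /= => /andP[].
case: (ltngtP d 1) => // d1.
  have d0 : d = 0%N by case: d d1 {dvd}.
  by have [|x2 y2] := dvd 2%N; [rewrite d0 | case: (xy 2%N isT x2)].
have [px py] := dvd _ (pdiv_dvd d).
by case: (xy _ (pdiv_prime d1) px).
Qed.

Lemma prime_ndvdz_coprime p (x y : int) : prime p -> coprimez x y ->
  (p%:Z %| x)%Z -> ~~ (p%:Z %| y)%Z.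
Proof.
move=> pr_p cop px; apply/negP => py; have := prime_gt1 pr_p.
suff : (p %| 1)%N by rewrite dvdn1 => /eqP->.
by move: cop px py; rewrite coprimezE !dvdzE /= => /eqP <-; rewrite dvdn_gcd => -> ->.
Qed.

Lemma Euclid_dvdzM p (x y : int) : prime p ->
  (p%:Z %| x * y)%Z = (p%:Z %| x)%Z || (p%:Z %| y)%Z.
Proof. by move=> pr_p; rewrite !dvdzE abszM Euclid_dvdM. Qed.

(** A unit modulo m has a representative prime to any given N: add to z the
    multiple k m, where k is the part of N prime to z. A prime dividing N
    divides exactly one of z and k, and one that divides z does not divide m.
    *)
Lemma coprimez_shift (z m N : int) : coprimez z m -> N != 0 ->
  exists2 w, (m %| w - z)%Z & coprimez w N.
Proof.
move=> zm N0.
suff aux x : x != 0 -> coprimez x m -> exists2 w, (m %| w - x)%Z & coprimez w N.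
  (* If z = 0, then m is a unit and may take the place of z. *)
  have [z0|z0] := eqVneq z 0; last exact: aux.
  rewrite z0 in zm *.
  have m0 : m != 0 by apply/eqP => m0; rewrite m0 in zm.
  have [|w mw wN] := aux m m0; first by move: zm; rewrite !coprimezE /coprime gcd0n gcdnn.
  by exists w => //; rewrite subr0 -[w](subrK m) rpredD // dvdzz.
move=> x0 xm.
pose k := (`|N|%N`_(\pi(`|x|%N)^'))%N.
exists (x + k%:Z * m); first by rewrite addrC addKr dvdz_mull.
apply: coprimez_by_primes => p pr_p pw pN.
have px_pi : (p \in \pi(`|x|%N)) = (p %| `|x|)%N.
  by rewrite mem_primes pr_p absz_gt0 x0.
have pk : (p %| k)%N = ~~ (p %| `|x|)%N.
  have : p \in primes k = ~~ (p %| `|x|)%N.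
    rewrite primes_part mem_filter inE /= px_pi mem_primes pr_p absz_gt0 N0.
    by move: pN; rewrite dvdzE /= => ->; rewrite andbT.
  by rewrite mem_primes pr_p part_gt0.
have [px|npx] := boolP (p %| `|x|)%N.
  have : (p%:Z %| k%:Z * m)%Z by move: pw; rewrite rpredDl // dvdzE.
  rewrite Euclid_dvdzM // dvdzE /= pk px /= => pm.
  by case/negP: (prime_ndvdz_coprime pr_p xm px).
have pkm : (p%:Z %| k%:Z * m)%Z by rewrite Euclid_dvdzM // dvdzE /= pk npx.
by case/negP: npx; move: pw; rewrite rpredDr // dvdzE.
Qed.

Lemma intr_Zp_eq0 n (z : int) : (1 < n)%N -> (z%:~R == 0 :> 'Z_n) = (n%:Z %| z)%Z.
Proof.
move=> n1; have nat0 k : (k%:R == 0 :> 'Z_n) = (n %| k)%N.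
  by rewrite -(inj_eq val_inj) /= val_Zp_nat // mod0n.
by case: z => k; rewrite ?NegzE ?mulrNz ?oppr_eq0 ?dvdzE nat0.
Qed.

Lemma unit_Zp_intr n (z : int) : (1 < n)%N ->
  (z%:~R \is a @GRing.unit 'Z_n) = coprimez z n%:Z.
Proof.
move=> n1; rewrite coprimezE coprime_sym.
by case: z => k; rewrite ?NegzE ?mulrNz ?unitrN unitZpE.
Qed.

Definition residue n (z : int) (u : {unit 'Z_n}) :=
  (n%:Z %| z - (val u : nat)%:Z)%Z.

Lemma residueE n z (u : {unit 'Z_n}) : (1 < n)%N ->
  residue z u = (z%:~R == val u :> 'Z_n).
Proof.
move=> n1; rewrite /residue -intr_Zp_eq0 // rmorphB /= subr_eq0.
by rewrite -[((val u : nat)%:Z)%:~R]/((val u : nat)%:R) natr_Zp.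
Qed.

(** The type of residues modulo 1 is implemented as the integers modulo 2,
    whose unit group is trivial as well. *)
Lemma unit_Z1 (u v : {unit 'Z_1}) : u = v.
Proof.
apply/val_inj/val_inj; have: \val u \is a GRing.unit by apply: valP.
have: \val v \is a GRing.unit by apply: valP.
by case: (\val u) (\val v) => [[|[|]]] //= ? [[|[|]]].
Qed.

Lemma residue_coprime n z (u : {unit 'Z_n}) : (0 < n)%N ->
  residue z u -> coprimez z n%:Z.
Proof.
case: n u => [|[|n]] // u _; first by rewrite coprimezE coprimen1.
by rewrite residueE // -unit_Zp_intr // => /eqP ->; apply: valP.
Qed.

Lemma coprime_residue n z : (0 < n)%N -> coprimez z n%:Z ->
  exists u : {unit 'Z_n}, residue z u.
Proof.
case: n => [|[|n]] // _ zn; first by exists 1%g; rewrite /residue dvd1z.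
by move: zn; rewrite -unit_Zp_intr // => uz; exists (FinRing.Unit uz); rewrite residueE.
Qed.

Lemma residueM n z w (u v : {unit 'Z_n}) : (0 < n)%N ->
  residue z u -> residue w v -> residue (z * w) (u * v)%g.
Proof.
case: n u v => [|[|n]] // u v _; first by rewrite /residue !dvd1z.
by rewrite !residueE // => /eqP zu /eqP wv; rewrite rmorphM /= zu wv.
Qed.

Lemma mem_pm1 n (u : {unit 'Z_n}) :
  (u \in pm1 n) = (\val u == 1) || (\val u == -1).
Proof.
apply/idP/idP => [/cycleP[k ->]|].
  rewrite FinRing.val_unitX /= -signr_odd.
  by case: odd; rewrite ?expr0 ?expr1 eqxx ?orbT.
case/orP => /eqP e.
  by rewrite (_ : u = 1%g) ?group1 //; apply: val_inj.
by rewrite (_ : u = FinRing.Unit (unitrN1 _)) ?cycle_id //; apply: val_inj.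
Qed.

Lemma pm1_norm n (u : {unit 'Z_n}) : u \in 'N(pm1 n).
Proof.
by rewrite (subsetP (sub_abelian_norm (units_Zp_abelian n) (subsetT _))) ?inE.
Qed.

Lemma coset_pm1P n z w (u v : {unit 'Z_n}) : (0 < n)%N ->
    residue z u -> residue w v ->
  coset (pm1 n) u = coset (pm1 n) v <->
    exists2 s : int, s ^+ 2 = 1 & (n%:Z %| s * z - w)%Z.
Proof.
case: n u v => [|[|n]] // u v _.
  move=> _ _; split=> _; first by exists 1; rewrite ?dvd1z.
  by rewrite (unit_Z1 u v).
rewrite !residueE // => /eqP zu /eqP wv; split.
  move/rcoset_kercosetP => /(_ (pm1_norm _) (pm1_norm _)).
  rewrite mem_rcoset mem_pm1 => uv.
  have {uv} uv : \val u = \val v \/ \val u = - \val v.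
    rewrite -[u](mulgKV v) FinRing.val_unitM.
    by case/orP: uv => /eqP ->; [left; rewrite mul1r | right; rewrite mulN1r].
  case: uv => uv; [exists 1 | exists (-1)] => //; rewrite -intr_Zp_eq0 // rmorphB /=.
    by rewrite mul1r zu wv uv subrr.
  by rewrite mulN1r rmorphN /= zu wv uv opprK subrr.
case=> s s2 e; apply/rcoset_kercosetP; rewrite ?pm1_norm // mem_rcoset mem_pm1.
move: e; rewrite -intr_Zp_eq0 // rmorphB /= subr_eq0 rmorphM /= zu wv => /eqP e.
rewrite -(e : _ = FinRing.uval v).
have /orP[] : (s == 1) || (s == -1) by rewrite -eqf_sqr s2 expr1n.
  by move=> /eqP s1; rewrite s1 mul1r divrr ?eqxx //; apply: valP.
move=> /eqP s1; rewrite s1 rmorphN1 mulN1r invrN mulrN divrr ?eqxx ?orbT //.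
exact: valP.
Qed.

End IntegerResidues.

(** * Integer representatives of twists *)

Section Representatives.
Variable gT : finGroupType.
Implicit Types (H K : {group gT}) (a b : twist gT) (alpha beta : T_inv gT).
Notation G := [set: gT]%G.

Lemma representsP a alpha : represents a alpha <->
  forall H, exists2 u : {unit 'Z_#|G : H|}, residue (a H) u &
    (alpha : {dffun forall H, _}) H = coset _ u.
Proof.
by split=> h H; have [u hu ->] := h H; exists u => //; move: hu;
  rewrite /residue -eqz_mod_dvd => /eqP.
Qed.

Lemma ex_represents alpha (N : int) : N != 0 ->
  exists2 a, represents a alpha & forall H, coprimez (a H) N.
Proof.
move=> N0.
have /choice[a aE] H : exists z : int, coprimez z N /\
    exists2 u : {unit 'Z_#|G : H|}, residue z u &
      (alpha : {dffun forall H, _}) H = coset _ u.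
  have [u _ ->] := cosetP ((alpha : {dffun forall H, _}) H).
  have uu : residue (val u : nat)%:Z u by rewrite /residue subrr dvdz0.
  have [z zu zN] := coprimez_shift (residue_coprime (indexg_gt0 _ _) uu) N0.
  by exists z; split=> //; exists u.
exists [ffun H => a H] => [|H]; last by rewrite ffunE; case: (aE H).
by apply/representsP => H; rewrite ffunE; case: (aE H).
Qed.

Lemma ex_represented a : (forall H, coprimez (a H) #|G : H|%:Z) ->
  exists alpha, represents a alpha.
Proof.
move=> ca.
pose u H : {unit 'Z_#|G : H|} :=
  sval (cid (coprime_residue (indexg_gt0 G H) (ca H))).
exists ([ffun H => coset _ (u H)] : {dffun forall H, coset_of (pm1 #|G : H|)}).
apply/representsP => H; exists (u H); rewrite ?ffunE //.
exact: (svalP (cid (coprime_residue (indexg_gt0 G H) (ca H)))).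
Qed.

Lemma represents_eqP a b alpha beta : represents a alpha -> represents b beta ->
  alpha = beta <-> exists2 s : twist gT, forall K, s K ^+ 2 = 1 &
    forall K, (#|G : K|%:Z %| s K * a K - b K)%Z.
Proof.
move=> /representsP ra /representsP rb; split=> [eab|[s s2 sab]].
  have /choice[s sE] K : exists s : int, s ^+ 2 = 1 /\
      (#|G : K|%:Z %| s * a K - b K)%Z.
    have [u au eu] := ra K; have [v bv ev] := rb K.
    have [s s2 sab] : exists2 s : int, s ^+ 2 = 1 & (#|G : K|%:Z %| s * a K - b K)%Z.
      by apply/(coset_pm1P (indexg_gt0 _ _) au bv); rewrite -eu -ev eab.
    by exists s.
  by exists [ffun K => s K] => K; rewrite ffunE; case: (sE K).
apply/ffunP => K; have [u au ->] := ra K; have [v bv ->] := rb K.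
by apply/(coset_pm1P (indexg_gt0 _ _) au bv); exists (s K).
Qed.

Lemma represents_mul a b alpha beta : represents a alpha -> represents b beta ->
  represents (twist_mul a b) (alpha * beta)%g.
Proof.
move=> /representsP ra /representsP rb; apply/representsP => K.
have [u au eu] := ra K; have [v bv ev] := rb K.
exists (u * v)%g; first by rewrite ffunE residueM ?indexg_gt0.
by rewrite coset_morphM ?pm1_norm // -eu -ev [LHS]ffunE.
Qed.

End Representatives.

(** * The homomorphism from twists to the Picard groups *)

Section TwistedClasses.
Variables (gT : finGroupType) (abG : abelian [set: gT]).
Implicit Types (H J K L : {group gT}) (a b c : twist gT) (alpha beta : T_inv gT).
Notation G := [set: gT]%G.
Notation MA := (twisted_mackey abG).
Notation one := (twist_one gT).

(** Representatives differ by signs, which rescale the coordinates, and by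
    congruences, which leave the lattice unchanged. *)
Lemma twist_iso a b alpha : represents a alpha -> represents b alpha ->
  mackey_iso (MA a) (MA b).
Proof.
move=> ra rb; have [|s s2 sab] := (represents_eqP ra rb).1; first by [].
have ss K : s K * s K = 1 by rewrite -expr2.
have rr L : twist_r s L * twist_r s L = 1.
  by rewrite /twist_r -big_split /= big1.
apply: (@lattice_iso _ _ _ _ (twist_r s)) => // S f lf.
  apply: (@lattice_congr _ _ (twist_mul s a)) => [K|]; first by rewrite ffunE.
  exact: lattice_sign.
apply: (@lattice_congr _ _ (twist_mul s b)); last exact: lattice_sign.
move=> K; rewrite ffunE -[a K]mul1r -(ss K) -mulrA -mulrBr dvdz_mull //.
by rewrite -opprB rpredN.
Qed.

Lemma twisted_classE a alpha : represents a alpha ->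
  twisted_class abG alpha = mackey_iso (MA a).
Proof.
move=> ra; apply: funext => M; apply: propext; split=> [[b rb]|].
  exact: mackey_iso_trans (twist_iso ra rb).
by exists a.
Qed.

Lemma twisted_module_classE a alpha : represents a alpha ->
  twisted_module_class abG alpha = module_iso (twisted_module abG a).
Proof.
move=> ra; apply: funext => M; apply: propext.
rewrite /twisted_module_class (twisted_classE ra); split=> [[N /ev_iso aN NM]|aM].
  exact: module_iso_trans (aN abG) NM.
by exists (MA a) => //; apply: (twist_iso ra ra).
Qed.

(** The entries of the inverse are inverses modulo |G : H|, chosen prime to
    all the entries of a at proper subgroups, so that the ratios of a and b
    are coprime. *)
Lemma ex_inverse a : (forall H, coprimez (a H) #|G|%:Z) ->
  exists b (x y : 'I_2 -> burnside abG G), compat a b one /\ dual_bases a b x y.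
Proof.
move=> ca.
pose N := \prod_(K : {group gT} | K != G) a K.
have N0 : N != 0.
  apply/prodf_neq0 => K neKG; apply/eqP => aK0.
  have := ca K; rewrite aK0 coprimezE /coprime gcd0n /= => /eqP n1.
  by case/eqP: neKG; apply/val_inj/eqP; rewrite eqEcard subsetT /= n1 cardG_gt0.
have /choice[b bE] H : exists b : int,
    (#|G : H|%:Z %| a H * b - 1)%Z /\ coprimez b N.
  have : coprimez (a H) #|G : H|%:Z.
    by apply: coprimez_dvdr (ca H); rewrite dvdn_indexg.
  case/coprimezP => -[u v] /= uv.
  have cu : coprimez u #|G : H|%:Z.
    by apply/coprimezP; exists (a H, v); rewrite /= -uv; ring.
  have [w wu wN] := coprimez_shift cu N0.
  exists w; split=> //.
  rewrite -[w](subrK u) mulrDr -addrA rpredD ?dvdz_mull //.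
  rewrite (_ : _ - 1 = - v * #|G : H|%:Z) ?dvdz_mull //.
  by rewrite -uv; ring.
have ab1 : compat a [ffun H => b H] one.
  by move=> K; rewrite !ffunE; case: (bE K).
have [x [y xy]] : exists x y : 'I_2 -> burnside abG G, dual_bases a [ffun H => b H] x y.
  apply: ex_dual_bases => // J.
  have coN K : K != G -> forall L, L != G -> coprimez (a K) (b L).
    move=> nK L nL; rewrite coprimez_sym; have [_] := bE L.
    by rewrite /N (bigD1 K) //= coprimezMr => /andP[].
  have nG K : ~~ (G \subset K) -> K != G by apply: contra => /eqP ->.
  apply: (big_rec (fun z => coprimez z _)) => [|K u /andP[_ /nG nK] IH].
    exact: coprime1n.
  rewrite coprimezMl IH andbT.
  apply: (big_rec (coprimez _)) => [|L v /andP[_ /nG nL] IHv].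
    by rewrite coprimezE coprimen1.
  by rewrite ffunE coprimezMr IHv coN.
by exists [ffun H => b H], x, y.
Qed.

Lemma card_neq0 : #|G|%:Z != 0 :> int.
Proof. by rewrite eqz_nat -lt0n cardG_gt0. Qed.

Lemma twisted_Pic_kMack alpha : Pic_kMack abG (twisted_class abG alpha).
Proof.
have [a ra ca] := ex_represents alpha card_neq0.
have [b [x [y [ab xy]]]] := ex_inverse ca.
exists (MA a), (MA b); split; last exact: twisted_classE.
- exact: twisted_kunneth ab xy.
- exact: twisted_kunneth (compatC ab) (dual_basesC xy).
exact: twisted_box ab xy.
Qed.

Lemma mark_tmul a b (u : twisted_module abG a) (v : twisted_module abG b) c :
  compat a b c -> exists w : burnside abG G, forall L,
  tmark c L w = tmark a L (u : burnside abG G) * tmark b L (v : burnside abG G).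
Proof.
by move=> abc; exists (tmul a b c u v) => L; rewrite tmark_tmul // subsetT.
Qed.

Lemma mark_tmul1 a b (u : twisted_module abG a) (v : twisted_module abG b) :
  compat a b one -> exists w : burnside abG G, forall L,
  mark L w = tmark a L (u : burnside abG G) * tmark b L (v : burnside abG G).
Proof.
by move=> /(mark_tmul u v)[w wE]; exists w => L; rewrite -tmark1.
Qed.

Lemma twisted_Pic_kMod alpha : Pic_kMod (twisted_module_class abG alpha).
Proof.
have [a ra ca] := ex_represents alpha card_neq0.
have [b [x [y [ab xy]]]] := ex_inverse ca.
pose tm c (v : twisted_module abG c) L := tmark c L (v : burnside abG G).
have ma := twisted_marking abG a; have mb := twisted_marking abG b.
exists (twisted_module abG a), (twisted_module abG b); split.
- by apply: (marked_kunneth (c' := tm b) ma _ xy) => u v; apply: mark_tmul1.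
- apply: (marked_kunneth (c' := tm a) mb _ (dual_basesC xy)) => u v.
  by apply: mark_tmul1; apply: compatC.
- apply: (marked_tensor (c' := tm b) ma _ xy mb (marking_regular abG)) => u v.
  + exact: mark_tmul1.
  + exact: mark_tmul1.
  have [w wE] := mark_tmul (v : twisted_module abG one) u (compat1l b).
  by exists w => L; rewrite wE mulrC tmark1.
exact: twisted_module_classE.
Qed.

(** With a' the inverse of a, the families of a' times those of ab are
    families of b, and [marked_tensor] applies. *)
Lemma twisted_tensor a b : (forall H, coprimez (a H) #|G|%:Z) ->
  module_tensor (twisted_module abG a) (twisted_module abG b)
    (twisted_module abG (twist_mul a b)).
Proof.
move=> /ex_inverse[a' [x [y [aa xy]]]].
pose tm c (v : twisted_module abG c) L := tmark c L (v : burnside abG G).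
have m c := twisted_marking abG c.
apply: (marked_tensor (c' := tm a') (m a) _ xy (m b) (m _)) => u v.
- exact: mark_tmul1.
- by apply: mark_tmul => K; rewrite ffunE subrr dvdz0.
apply: mark_tmul => K; rewrite ffunE mulrCA -{2}[b K]mul1r mulrA -mulrBl.
by rewrite dvdz_mulr //; have := aa K; rewrite ffunE.
Qed.

Lemma twisted_module_classM alpha beta :
  twisted_module_class abG (alpha * beta)%g =
    Pic_mul (twisted_module_class abG alpha) (twisted_module_class abG beta).
Proof.
have [a ra ca] := ex_represents alpha card_neq0.
have [b rb cb] := ex_represents beta card_neq0.
rewrite (twisted_module_classE (represents_mul ra rb)).
rewrite (twisted_module_classE ra) (twisted_module_classE rb).
have T := twisted_tensor b ca.
apply: funext => P; apply: propext; split=> [abP|[M [N [aM bN MNP]]]].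
  exists (twisted_module abG a), (twisted_module abG b).
  by split; [exact: module_iso_refl | exact: module_iso_refl | exact: tensor_isor abP].
exact: tensor_unique T (tensor_isol MNP aM bN).
Qed.

End TwistedClasses.

(** * Injectivity *)

Section Principal.
Variables (gT : finGroupType) (abG : abelian [set: gT]).
Implicit Types (H J K L : {group gT}) (a b : twist gT) (g : {group gT} -> int).
Notation G := [set: gT]%G.
Notation AG := (burnside abG G).
Notation n := (#|[set: gT]|%:Z).

(** Multiples of |G| on a single coordinate: subtract from |L| times the class
    of G/L, which has the mark |G| at all subgroups of L, the elements already
    found for the proper subgroups of L. *)
Lemma ex_delta L : exists u : AG, forall K, mark K u = if K == L then n else 0.
Proof.
elim: {L}_.+1 {-2}L (ltnSn #|L|) => // m IH L leLm.
have /choice[w wE] K : exists u : AG, K \proper L ->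
    forall M : {group gT}, mark M u = if M == K then n else 0.
  have [pKL|] := boolP (K \proper L); last by exists 0.
  have [u uE] := IH K (leq_trans (proper_card pKL) leLm).
  by exists u.
exists (orb abG G L *~ #|L|%:Z - \sum_(K : {group gT} | K \proper L) w K) => M.
pose F : {additive AG -> int} := @mark gT abG G M.
rewrite (raddfB F) (raddfMz F) (raddf_sum F) /= mark_orb ?subsetT //.
have -> : \sum_(K : {group gT} | K \proper L) mark M (w K) =
    \sum_(K : {group gT} | (K \proper L) && (M == K)) n.
  by rewrite [RHS]big_mkcondr; apply: eq_bigr => K /wE.
have -> : (if M \subset L then #|G : L|%:Z else 0) *~ #|L| = if M \subset L then n else 0.
  case: ifP => _; last by rewrite mul0rz.
  by rewrite mulrzz -PoszM mulnC Lagrange ?subsetT.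
have [eML|neML] := eqVneq M L.
  rewrite eML subxx big1 ?subr0 // => K /andP[pKL /eqP eLK].
  by rewrite eLK properxx in pKL.
case: ifP => sML; last first.
  rewrite big1 ?subr0 // => K /andP[pKL /eqP eMK].
  by rewrite eMK proper_sub in sML.
rewrite (bigD1 M) /=; last first.
  rewrite eqxx andbT properEneq sML andbT.
  by apply: contra neML => /eqP e; apply/eqP/val_inj.
rewrite big1 ?addr0 ?subrr // => K /andP[/andP[_ /eqP eMK]].
by rewrite eMK eqxx.
Qed.

Section MarkedPrincipal.
Variables (M : lmodType AG) (c : M -> {group gT} -> int).
Hypotheses (mc : marking c) (c1 : forall L, exists x, c x L = 1).

(** The image of a marked module with surjective coordinates contains all
    families divisible by |G|, so it is determined by its reduction modulo
    |G|. *)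
Lemma marked_ghost g : exists x, forall L, c x L = n * g L.
Proof.
have /choice[u uE] := ex_delta.
have [x xE] := choice c1.
exists (\sum_K (u K *~ g K) *: x K) => L.
rewrite (marking_sum mc) (bigD1 L) //= (markingZ mc) raddfMz /= uE eqxx.
rewrite xE mulr1 mulrzz big1 ?addr0 // => K neKL.
by rewrite (markingZ mc) raddfMz /= uE eq_sym (negPf neKL) mul0rz mul0r.
Qed.

(** Modulo |G| the module is generated by e; since it also contains all
    multiples of |G|, its image is described by congruences. *)
Lemma marked_principal (e : M) :
    (forall x, exists y : AG, forall L, (n %| c x L - c e L * mark L y)%Z) ->
  forall g, (exists x, forall L, c x L = g L) <->
    exists y : AG, forall L, (n %| g L - c e L * mark L y)%Z.
Proof.
move=> princ g; split=> [[x xE]|[y yE]].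
  by have [y yE] := princ x; exists y => L; rewrite -xE.
have /choice[q qE] L : exists q, g L - c e L * mark L y = q * n.
  by have /dvdzP[q qE] := yE L; exists q.
have [x xE] := marked_ghost q; exists (x + y *: e) => L.
rewrite (markingD mc) (markingZ mc) xE mulrC -qE; ring.
Qed.

End MarkedPrincipal.

Lemma twist_r_coprime a : (forall K, coprimez (a K) n) ->
  forall L, coprimez (twist_r a L) n.
Proof.
move=> ca L; apply: (big_rec (fun z => coprimez z _)) => [|K u _ IH].
  by rewrite coprimezE coprime1n.
by rewrite coprimezMl ca.
Qed.

Lemma tmark_orbG a L : tmark a L (orb abG G G *~ a G) = twist_r a L.
Proof.
rewrite raddfMz /= tmark_orb // subsetT indexgg mul1r (twist_ratioP a (subsetT L)).
rewrite mulrzz; congr (_ * _); rewrite /twist_r (big_pred1 G) // => K /=.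
by apply/idP/eqP => [sGK|->//]; apply/val_inj/eqP; rewrite eqEsubset sGK subsetT.
Qed.

Section CoprimeTwist.
Variable a : twist gT.
Hypothesis ca : forall K, coprimez (a K) n.

(** At L the class of G/L has the mark |G : L| and the class of G/G has a mark
    prime to |G|. *)
Lemma twisted_unit L : exists x : twisted_module abG a, tmark a L (x : AG) = 1.
Proof.
have /coprimezP[[u v] /= uv] : coprimez (twist_r a L) #|G : L|%:Z.
  by apply: coprimez_dvdr (twist_r_coprime ca L); apply: dvdn_indexg.
exists ((orb abG G G *~ a G) *~ u + orb abG G L *~ v : AG).
rewrite raddfD /= [tmark a L (_ *~ u)]raddfMz /= tmark_orbG raddfMz /= tmark_orb ?subsetT //.
by rewrite subxx twist_ratio_id mulr1 !mulrzz -uv; ring.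
Qed.

(** The generator modulo |G| is the family of the r_L: on the class of G/J, it
    gives r_J v_J, and r_J is invertible modulo |G|. *)
Lemma twisted_principal g : lattice abG a G g <->
  exists y : AG, forall L, (n %| g L - twist_r a L * mark L y)%Z.
Proof.
have P := @marked_principal _ _ (twisted_marking abG a) twisted_unit (orb abG G G *~ a G : AG).
have -> : lattice abG a G g <-> exists x : AG, forall L, tmark a L x = g L.
  by split=> -[x xE]; exists x => L; rewrite ?xE ?subsetT.
have {}P := P _ g; rewrite P => [|x].
  by split=> -[y yE]; exists y => L; move: (yE L); rewrite tmark_orbG.
elim/burnside_ind: (x : AG) => [|u v [u1 uE] [v1 vE]|J sJG].
- by exists 0 => L; rewrite !raddf0 mulr0 subr0 dvdz0.
- exists (u1 - v1) => L; rewrite !raddfB /=.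
  rewrite (_ : _ - _ = (tmark a L u - tmark a L (orb abG G G *~ a G) * mark L u1) -
    (tmark a L v - tmark a L (orb abG G G *~ a G) * mark L v1)); last by ring.
  by rewrite rpredB.
have /coprimezP[[k l] /= kl] := twist_r_coprime ca J.
exists (orb abG G J *~ k) => L.
rewrite tmark_orbG raddfMz /= tmark_orb // mark_orb //.
case: ifP => sLJ; last by rewrite mul0rz mulr0 subr0 dvdz0.
rewrite (twist_ratioP a sLJ) mulrzz.
rewrite (_ : _ - _ = #|G : J|%:Z * twist_ratio a J L * l * n) ?dvdz_mull //.
rewrite -[RHS]mulrA; have -> : l * n = 1 - k * twist_r a J by rewrite -kl; ring.
by ring.
Qed.

End CoprimeTwist.

(** Moebius inversion on the subgroups: the a_L are chosen by descending order
    of L, the product of the a_K over the K properly containing L being known.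
    It is applied to signs and to residues modulo |G|, whence the relation R
    in place of an equality. *)
Lemma ex_twist_r (P : int -> Prop) (R : {group gT} -> int -> Prop) :
    P 1 -> (forall x y, P x -> P y -> P (x * y)) ->
    (forall L z, P z -> exists2 x, P x & R L (x * z)) ->
  exists a, (forall K, P (a K)) /\ forall L, R L (twist_r a L).
Proof.
move=> P1 PM PR.
suff step k : exists a, (forall K, P (a K)) /\
    forall L, (#|G| < #|L| + k)%N -> R L (twist_r a L).
  have [a [Pa Ra]] := step #|G|.+1; exists a; split=> // L; apply: Ra.
  by rewrite addnS ltnS leq_addl.
elim: k => [|k [a [Pa Ra]]].
  exists [ffun=> 1]; split=> [K|L]; first by rewrite ffunE.
  by rewrite addn0 ltnNge subset_leq_card ?subsetT.
have /choice[x xE] L : exists x, P x /\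
    R L (x * \prod_(K : {group gT} | (L \subset K) && (K != L)) a K).
  have [|x] := PR L (\prod_(K : {group gT} | (L \subset K) && (K != L)) a K).
    by apply: big_ind.
  by exists x.
exists [ffun L : {group gT} => if (#|G| == #|L| + k)%N then x L else a L]; split=> [K|L ltL].
  by rewrite ffunE; case: ifP => // _; case: (xE K).
have [eL|neL] := eqVneq #|G| (#|L| + k)%N.
  rewrite /twist_r (bigD1 L) //= ffunE eL eqxx.
  rewrite (eq_bigr a) => [|K /andP[sLK neKL]]; first by case: (xE L).
  rewrite ffunE; case: eqP => // /eqP.
  rewrite eqn_add2r => /eqP eLK; case/eqP: neKL; apply/val_inj/eqP.
  by rewrite eq_sym eqEcard sLK eLK /=.
have {neL} ltL' : (#|G| < #|L| + k)%N.
  by rewrite ltn_neqAle neL -ltnS -addnS.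
rewrite (_ : twist_r _ L = twist_r a L); first exact: Ra.
apply: eq_bigr => K sLK; rewrite ffunE; case: eqP => // eK.
have := subset_leq_card sLK; rewrite leqNgt; case/negP.
by rewrite -(ltn_add2r k) -eK.
Qed.

Section IsoSigns.
Variables (M N : lmodType AG) (c : M -> {group gT} -> int) (d : N -> {group gT} -> int).
Hypotheses (mc : marking c) (md : marking d).
Hypotheses (c1 : forall L, exists x, c x L = 1) (d1 : forall L, exists y, d y L = 1).

(** By [ex_delta] each coordinate is separated from the others by an element
    of the Burnside ring, so a linear map rescales it; an isomorphism does so
    by a unit of the integers. *)
Lemma marked_iso_sign : module_iso M N ->
  exists (f : M -> N) (e : {group gT} -> int),
    (forall L, e L ^+ 2 = 1) /\ forall x L, d (f x) L = e L * c x L.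
Proof.
case=> f [f' fK f'K].
have cross x x' L : c x' L * d (f x) L = c x L * d (f x') L.
  have [u uE] := ex_delta L.
  (* Both sides vanish away from L and agree at L. *)
  have : (u *: x) *~ c x' L = (u *: x') *~ c x L.
    apply: (marking_inj mc) => K; rewrite !(markingMz mc) !(markingZ mc) uE.
    by case: eqP => [->|_]; ring.
  move/(congr1 (fun z => d (f z) L)).
  rewrite !raddfMz /= !linearZ /= !(markingMz md) !(markingZ md) uE eqxx => e.
  have n0 : n != 0 by exact: card_neq0.
  by apply: (mulfI n0); rewrite (mulrC (c x' L)) (mulrC (c x L)) !mulrA.
have /choice[x0 x0E] := c1.
exists f, (fun L => d (f (x0 L)) L); split=> [L|x L]; last first.
  by have := cross x (x0 L) L; rewrite x0E mul1r mulrC.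
have [y yE] := d1 L; have := cross (f' y) (x0 L) L.
rewrite f'K yE x0E mul1r => /esym e1.
have : (d (f (x0 L)) L \is a GRing.unit).
  by apply/unitrPr; exists (c (f' y) L); rewrite mulrC.
by case/orP => /eqP ->.
Qed.

End IsoSigns.

(** The isomorphism rescales coordinates by signs, which are the r_L of a sign
    twist s; hence the family r of s a lies in the lattice of b. By descending
    order of H, the entries of b above H may be replaced with those of s a,
    and then the families r of s a and of b agree above H. Their difference
    lies in the lattice, so its value (s_H a_H - b_H) prod_{K > H} s_K a_K at
    H is divisible by |G : H|, and the product is prime to |G|. *)
Lemma twisted_module_iso_congr a b :
    (forall K, coprimez (a K) n) -> (forall K, coprimez (b K) n) ->
    module_iso (twisted_module abG a) (twisted_module abG b) ->
  exists2 s : twist gT, forall K, s K ^+ 2 = 1 &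
    forall K, (#|G : K|%:Z %| s K * a K - b K)%Z.
Proof.
move=> ca cb /(marked_iso_sign (twisted_marking abG a) (twisted_marking abG b)
  (twisted_unit ca) (twisted_unit cb))[f [e [e2 fE]]].
have [s [s2 sE]] : exists s : twist gT,
    (forall K, s K ^+ 2 = 1) /\ forall L, twist_r s L = e L.
  apply: (@ex_twist_r (fun z => z ^+ 2 = 1) (fun L z => z = e L)).
  - exact: expr1n.
  - by move=> x y x2 y2; rewrite exprMn x2 y2 mul1r.
  move=> L z z2; exists (e L * z); first by rewrite exprMn e2 z2 mul1r.
  by rewrite -mulrA -expr2 z2 mulr1.
exists s => // H0; pose a' := twist_mul s a.
have a'E K : a' K = s K * a K by rewrite ffunE.
have la' : lattice abG b G (twist_r a').
  exists (f (orb abG G G *~ a G : AG)) => L _; rewrite fE tmark_orbG -sE.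
  by rewrite /twist_r -big_split; apply: eq_bigr => K _; rewrite ffunE.
elim: {H0}_.+1 {-2}H0 (ltnSn (#|G| - #|H0|)) => // k IH H leHk.
(* b' agrees with s a strictly above the order of H and with b elsewhere. *)
pose b' : twist gT := [ffun K : {group gT} => if (#|H| < #|K|)%N then a' K else b K].
have bb' K : (#|G : K|%:Z %| b K - b' K)%Z.
  rewrite ffunE; case: ifP => [ltHK|_]; last by rewrite subrr dvdz0.
  rewrite -opprB rpredN a'E; apply: IH.
  have ltHG := leq_trans ltHK (subset_leq_card (subsetT K)).
  by apply: (leq_trans (ltn_sub2l ltHG ltHK)); rewrite -ltnS.
have [w wE] : lattice abG b' G (fun L => twist_r a' L - twist_r b' L).
  apply: latticeB; first exact: lattice_congr bb' la'.
  by exists (orb abG G G *~ b' G) => L _; rewrite tmark_orbG.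
have top0 K : K \subset G -> (#|H| < #|K|)%N -> tmark b' K w = 0.
  move=> sKG ltHK; rewrite wE // (_ : twist_r b' K = twist_r a' K) ?subrr //.
  apply: eq_bigr => L sKL; rewrite [LHS]ffunE.
  by rewrite (leq_trans ltHK (subset_leq_card sKL)).
have := tmark_top (subsetT H) top0; rewrite wE ?subsetT //.
rewrite /twist_r (bigD1 H) //= [X in _ - X](bigD1 H) //= [b' H]ffunE ltnn.
rewrite [X in _ * _ - _ * X](eq_bigr a') => [|K /andP[sHK neKH]]; last first.
  rewrite ffunE ltn_neqAle subset_leq_card // andbT; case: eqP => //= eHK.
  by case/eqP: neKH; apply/val_inj/eqP; rewrite eq_sym eqEcard sHK eHK /=.
rewrite -mulrBl Gauss_dvdzl ?a'E //.
rewrite coprimez_sym; apply: (@coprimez_dvdr _ #|G|); first exact: dvdn_indexg.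
apply: (big_rec (fun z => coprimez z _)) => [|K u _ IHu].
  by rewrite coprimezE coprime1n.
have cs : coprimez (s K) n.
  by apply/coprimezP; exists (s K, 0); rewrite /= mul0r addr0 -expr2 s2.
by rewrite coprimezMl IHu a'E coprimezMl cs ca.
Qed.

Lemma twisted_module_class_inj : injective (@twisted_module_class gT abG).
Proof.
move=> alpha beta eab.
have [a ra ca] := ex_represents alpha (card_neq0 gT).
have [b rb cb] := ex_represents beta (card_neq0 gT).
apply/(represents_eqP ra rb)/twisted_module_iso_congr => //.
by rewrite -(twisted_module_classE abG ra) eab (twisted_module_classE abG rb);
  apply: module_iso_refl.
Qed.

End Principal.

(** * Surjectivity *)

Lemma additive_generator (V : zmodType) (phi : {additive V -> int}) :
  (exists v, phi v != 0) ->
  exists v0, phi v0 != 0 /\ forall v, (phi v0 %| phi v)%Z.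
Proof.
move=> [w w0].
have exk : exists k, `[< exists2 v, phi v != 0 & `|phi v|%N = k >].
  by exists `|phi w|%N; apply/asboolP; exists w.
case: (ex_minnP exk) => k /asboolP[v0 nz <-] kmin.
exists v0; split=> // v; apply/negPn/negP => ndvd.
have r0 : (phi v %% phi v0)%Z != 0.
  by apply: contra ndvd => /eqP/dvdz_mod0P.
have rE : phi (v - v0 *~ (phi v %/ phi v0)%Z) = (phi v %% phi v0)%Z.
  rewrite raddfB raddfMz /= mulrzz [X in X - _ = _](divz_eq (phi v) (phi v0)); ring.
have /kmin : `[< exists2 u, phi u != 0 & `|phi u|%N = `|(phi v %% phi v0)%Z|%N >].
  by apply/asboolP; exists (v - v0 *~ (phi v %/ phi v0)%Z); rewrite rE.
by rewrite leqNgt -ltz_nat gez0_abs ?modz_ge0 // abszE ltz_mod.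
Qed.

(** The exponent is twice the totient of n, so that the sign of z is
    irrelevant; it is written as a successor to exhibit an inverse of z modulo
    n as a power of z. *)
Lemma Euler_coprimez (n : nat) (z : int) : (0 < n)%N -> coprimez z n%:Z ->
  (n%:Z %| z ^+ (totient n).*2.-1.+1 - 1)%Z.
Proof.
move=> n0 zn; rewrite prednK ?double_gt0 ?totient_gt0 //.
rewrite -mul2n exprM.
have -> : z ^+ 2 = (`|z| ^ 2)%N%:Z by rewrite -abszX gez0_abs ?sqr_ge0.
rewrite -rmorphXn /= -eqz_mod_dvd; apply/eqP.
have cop : coprime (`|z| ^ 2) n by rewrite coprimeXl //; move: zn; rewrite coprimezE.
by have := Euler_exp_totient cop; rewrite !modz_nat => ->.
Qed.

Section Avoidance.
Variables (gT : finGroupType) (abG : abelian [set: gT]).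
Implicit Types (H K L : {group gT}).
Notation G := [set: gT]%G.
Notation AG := (burnside abG G).
Variables (M N : lmodType AG).
Variables (c : M -> {group gT} -> int) (d : N -> {group gT} -> int).
Hypotheses (cD : forall x y L, c (x + y) L = c x L + c y L)
  (cZ : forall u x L, c (u *: x) L = mark L u * c x L).
Hypothesis cd : forall x y, exists u : AG, forall L, mark L u = c x L * d y L.
Hypotheses (c_prime : forall L p, prime p -> exists x, ~~ (p%:Z %| c x L)%Z)
  (d_prime : forall L p, prime p -> exists y, ~~ (p%:Z %| d y L)%Z).

(** The prime ideals of pairs (H, p) and (K, q) are either separated by an
    element of the Burnside ring, or p = q and the marks at H and K agree
    modulo p. In the latter case, multiplying by y shows that x has a unit
    coordinate at K if it has one at H. *)
Lemma mark_separates x H K p q : prime p -> prime q ->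
    ~~ (p%:Z %| c x H)%Z -> (q%:Z %| c x K)%Z ->
  exists2 u : AG, (p%:Z %| mark H u)%Z & ~~ (q%:Z %| mark K u)%Z.
Proof.
move=> pr_p pr_q px qx; have [epq|nepq] := eqVneq p q; last first.
  exists (1 *~ p%:Z); rewrite raddfMz /= mark_one ?dvdz_mulr //.
    by rewrite mulrzz mul1r dvdzz.
  by rewrite mulrzz mul1r dvdzE /= dvdn_prime2 // eq_sym.
rewrite -{q}epq in pr_q qx *.
have [y py] := d_prime H pr_p; have [u uE] := cd x y.
have pu : ~~ (p%:Z %| mark H u)%Z by rewrite uE Euclid_dvdzM // negb_or px.
exists (u - 1 *~ mark H u); rewrite raddfB /= raddfMz /= mark_one mulrzz mul1r.
  by rewrite subrr dvdz0.
by apply: contra pu; rewrite rpredBl // uE dvdz_mulr.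
Qed.

(** Prime avoidance: if x fails at (K, q), an element m that does not,
    multiplied by one of the Burnside ring that vanishes modulo the previous
    primes and not at (K, q), corrects it. *)
Lemma ex_avoid_primes (s : seq ({group gT} * nat)) : all (fun q => prime q.2) s ->
  exists x, all (fun q => ~~ (q.2%:Z %| c x q.1)%Z) s.
Proof.
elim: s => [|[K q] s IH] /=; first by exists 0.
case/andP=> pr_q pr_s; have [x xs] := IH pr_s.
have [qx|] := boolP (q%:Z %| c x K)%Z; last by exists x; apply/andP.
have [m qm] := c_prime K pr_q.
have [u us qu] : exists2 u : AG, all (fun q => (q.2%:Z %| mark q.1 u)%Z) s &
    ~~ (q%:Z %| mark K u)%Z.
  elim: (s) pr_s xs => [|[H p] r IHr] /=.
    by exists 1 => //; rewrite mark_one dvdz1 /= neq_ltn prime_gt1 // orbT.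
  move=> /andP[pr_p pr_r] /andP[px xr]; have [u ur qu] := IHr pr_r xr.
  have [v pv qv] := mark_separates pr_p pr_q px qx.
  exists (u * v); last by rewrite mark_mulr Euclid_dvdzM // negb_or qu.
  rewrite mark_mulr dvdz_mull //=; apply: sub_all ur => -[L l] /= lu.
  by rewrite mark_mulr dvdz_mulr.
exists (x + u *: m); apply/andP; split.
  by rewrite cD cZ rpredDl // Euclid_dvdzM // negb_or qu.
apply/allP => -[L l] Ls /=; rewrite cD cZ rpredDr.
  by have /= := allP xs _ Ls.
by rewrite dvdz_mulr //; have /= := allP us _ Ls.
Qed.

Lemma ex_coprime_coordinates : exists x, forall L, coprimez (c x L) #|G|%:Z.
Proof.
pose s := [seq (L, p) | L <- enum {group gT}, p <- primes #|G|].
have [|x xs] := @ex_avoid_primes s.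
  by apply/allP => _ /allpairsP[[L p] /= [_ pG ->]] /=; move: pG; rewrite mem_primes => /andP[].
exists x => L; apply: coprimez_by_primes => p pr_p px pG.
suff /(allP xs) /= : (L, p) \in s by rewrite px.
apply/allpairsP; exists (L, p); split=> //=; first by rewrite mem_enum.
by move: pG; rewrite mem_primes pr_p cardG_gt0 dvdzE.
Qed.

End Avoidance.

Section InvertibleModules.
Variables (gT : finGroupType) (abG : abelian [set: gT]).
Implicit Types (H K L : {group gT}).
Notation G := [set: gT]%G.
Notation AG := (burnside abG G).
Notation n := (#|[set: gT]|%:Z).

Section Pairing.
Variables (M N : lmodType AG) (t : M -> N -> AG).
Hypothesis bt : @bilinear_map AG M N AG^o t.
Hypothesis tu : forall (Q : lmodType AG) (s : M -> N -> Q), bilinear_map s ->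
  exists2 f : {linear AG^o -> Q}, (forall x y, f (t x y) = s x y) &
    forall f' : {linear AG^o -> Q}, (forall x y, f' (t x y) = s x y) -> f' =1 f.

Let tlP k x x' y : t (k *: x + x') y = k * t x y + t x' y.
Proof. exact: bt.1. Qed.

Let trP k x y y' : t x (k *: y + y') = k * t x y + t x y'.
Proof. exact: bt.2. Qed.

Let t0l y : t 0 y = 0.
Proof. by have := tlP (-1) 0 0 y; rewrite scaler0 addr0 mulN1r addNr. Qed.

Let t0r x : t x 0 = 0.
Proof. by have := trP (-1) x 0 0; rewrite scaler0 addr0 mulN1r addNr. Qed.

Let tZl k x y : t (k *: x) y = k * t x y.
Proof. by have := tlP k x 0 y; rewrite addr0 t0l addr0. Qed.

Let tZr k x y : t x (k *: y) = k * t x y.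
Proof. by have := trP k x y 0; rewrite addr0 t0r addr0. Qed.

Let tBl x x' y : t (x - x') y = t x y - t x' y.
Proof. by have := tlP (-1) x' x y; rewrite scaleN1r mulN1r addrC => ->; rewrite addrC. Qed.

Let tDr x y y' : t x (y + y') = t x y + t x y'.
Proof. by have := trP 1 x y y'; rewrite scale1r mul1r. Qed.

(** By uniqueness in the universal property, as f and the zero map agree on
    the tensors; this says that the t(x, y) span the Burnside ring, without
    forming a quotient. *)
Lemma tensor_generates (Q : lmodType AG) (f : {linear AG^o -> Q}) :
  (forall x y, f (t x y) = 0) -> f =1 (fun=> 0).
Proof.
move=> f0.
have [|g _ gu] := @tu Q (fun _ _ => 0).
  by split=> [y|x] k u v; rewrite scaler0 addr0.
have [Z ZE] : exists Z : {linear AG^o -> Q}, Z =1 fun=> 0.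
  by apply: linear_mapP => k u v; rewrite scaler0 addr0.
by move=> u; rewrite (gu f f0) -(gu Z) ?ZE // => x y; rewrite ZE.
Qed.

(** Otherwise the reduction of the mark at H modulo d would be a nonzero
    linear map that vanishes on all the tensors. *)
Lemma pairing_nonzero H d : (1 < d)%N -> exists x y, ~~ (d%:Z %| mark H (t x y))%Z.
Proof.
move=> d1.
pose sc (u : AG) (m : 'Z_d) : 'Z_d := (mark H u)%:~R * m.
have scA u v m : sc u (sc v m) = sc (u * v) m.
  by rewrite /sc mark_mulr rmorphM /= mulrA.
have sc1 : left_id 1 sc by move=> m; rewrite /sc mark_one mul1r.
have scDr : right_distributive sc +%R by move=> u m m'; rewrite /sc mulrDr.
have scDl m : {morph sc^~ m : u v / u + v}.
  by move=> u v; rewrite /sc raddfD /= rmorphD /= mulrDl.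
(* the residues modulo d, with the Burnside ring acting through the mark at H *)
pose Q : lmodType AG := HB.pack 'I_(Zp_trunc d).+2
  (GRing.Zmodule_isLmodule.Build AG 'Z_d scA sc1 scDr scDl).
have [f fE] : exists f : {linear AG^o -> Q}, forall u, f u = (mark H (u : AG))%:~R :> 'Z_d.
  by apply: linear_mapP => k u v; rewrite raddfD /= rmorphD /= mark_mulr rmorphM.
apply: contrapT => no.
have /tensor_generates f0 x y : f (t x y) = 0.
  rewrite fE; apply/eqP; rewrite intr_Zp_eq0 //; apply/negPn/negP => h.
  by apply: no; exists x, y.
have /eqP := f0 1; rewrite fE mark_one.
by have := oner_neq0 ('Z_d) => /negPf ->.
Qed.

(** By the universal property applied to (x, y) |-> t(m, y) x. The proof of
    [pairing_rank1] shows that m' and m have the same pairings with N, as the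
    Burnside ring has no nilpotent elements. *)
Lemma pairing_swap m : exists m', forall x y, t m y *: x = t x y *: m'.
Proof.
have [|f fE _] := @tu M (fun x y => t m y *: x).
  split=> [y|x] k u v; first by rewrite scalerDr !scalerA mulrC.
  by rewrite trP scalerDl scalerA.
exists (f 1) => x y; rewrite -fE -linearZ; congr (f _).
by rewrite -[LHS]mulr1.
Qed.

(** Pairing [pairing_swap] with z gives the equation with m' for m. For x = m
    it shows that t(m, z) and t(m', z) have the same mark at H if some t(m, y)
    has a nonzero mark there. If there is none, all t(m', z) have the mark
    zero as well. *)
Lemma pairing_rank1 m x y z H :
  mark H (t m y) * mark H (t x z) = mark H (t x y) * mark H (t m z).
Proof.
have [m' m'E] := pairing_swap m.
have e x1 y1 z1 : mark H (t m y1) * mark H (t x1 z1) =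
    mark H (t x1 y1) * mark H (t m' z1).
  by rewrite -!mark_mulr -!tZl m'E.
suff -> : mark H (t m z) = mark H (t m' z) by [].
have [[y1 /eqP nz]|all0] := pselect (exists y1, mark H (t m y1) <> 0).
  by apply: (mulfI nz); rewrite -e.
have m0 y1 : mark H (t m y1) = 0.
  by apply: contrapT => nz; apply: all0; exists y1.
have [x0 [y0 xy0]] := pairing_nonzero H (ltnSn 1).
have nz : mark H (t x0 y0) != 0 by apply: contra xy0 => /eqP->; apply: dvdz0.
by apply: (mulfI nz); rewrite -e !m0 mul0r mulr0.
Qed.

(** If t(m, .) = 0, the linear map u |-> u m vanishes on the tensors by
    [pairing_swap], hence at 1. *)
Lemma pairing_nondegenerate m : (forall y, t m y = 0) -> m = 0.
Proof.
move=> m0.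
have [f fE] : exists f : {linear AG^o -> M}, forall u, f u = (u : AG) *: m.
  by apply: linear_mapP => k u v; rewrite scalerDl scalerA.
have /tensor_generates f0 x y : f (t x y) = 0.
  have [x' x'E] := pairing_swap x.
  by rewrite fE x'E m0 scale0r.
by have := f0 1; rewrite fE scale1r.
Qed.

(** At H the pairing is a form of rank one; dividing t(., y0) by the generator
    t(m0, y0) of its ideal of values gives a surjective coordinate on M and a
    complementary one on N. *)
Lemma ex_coordinate H : exists (cd : (M -> int) * (N -> int)),
  (forall m y, mark H (t m y) = cd.1 m * cd.2 y) /\
  exists m, cd.1 m = 1 /\ forall y, cd.2 y = mark H (t m y).
Proof.
have [x0 [y0 xy0]] := pairing_nonzero H (ltnSn 1).
have nz : mark H (t x0 y0) != 0 by apply: contra xy0 => /eqP->; apply: dvdz0.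
have pB : zmod_morphism (fun m => mark H (t m y0)).
  by move=> u v; rewrite tBl raddfB.
pose phi : {additive M -> int} := HB.pack (fun m => mark H (t m y0))
  (GRing.isZmodMorphism.Build _ _ _ pB).
have [|m0 [nz0 dvd]] := @additive_generator _ phi; first by exists x0.
exists ((fun m => mark H (t m y0) %/ mark H (t m0 y0))%Z, fun y => mark H (t m0 y)).
split=> [m y|] /=; last by exists m0; split=> //; rewrite divzz nz0.
apply: (mulIf (nz0 : mark H (t m0 y0) != 0)).
by rewrite mulrAC divzK ?dvd // pairing_rank1 mulrC.
Qed.

(** With e in M and f in N whose coordinates are prime to |G|, every x is
    congruent modulo |G| to (t(x, f) t(e, f)^k) e for a suitable power k, by
    Euler. So M is described by congruences modulo |G| in terms of the
    coordinates of e, and the twist a is obtained by solving r_L = e_L modulo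
    |G|. *)
Lemma pairing_twisted : exists2 a : twist gT, forall K, coprimez (a K) n &
  module_iso M (twisted_module abG a).
Proof.
have /choice[cd cdP] := ex_coordinate.
pose c m L := (cd L).1 m; pose d y L := (cd L).2 y.
have tE m y L : mark L (t m y) = c m L * d y L by case: (cdP L).
have c1 L : exists m, c m L = 1 by have [_ [m [m1 _]]] := cdP L; exists m.
have dE L : exists m, forall y, d y L = mark L (t m y).
  by have [_ [m [_ m1]]] := cdP L; exists m.
have d_prime L p : prime p -> exists y, ~~ (p%:Z %| d y L)%Z.
  move=> pr_p; have [x [y xy]] := pairing_nonzero L (prime_gt1 pr_p).
  by exists y; apply: contra xy; rewrite tE; apply: dvdz_mull.
have c_prime L p : prime p -> exists x, ~~ (p%:Z %| c x L)%Z.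
  by move=> pr_p; have [x x1] := c1 L; exists x; rewrite x1 dvdz1 /= neq_ltn prime_gt1 // orbT.
have d_nz L : exists y, d y L != 0.
  have [y y0] := d_prime L 2%N isT; exists y.
  by apply: contra y0 => /eqP ->; apply: dvdz0.
have mc : marking c.
  split=> [x y L|u x L|x y exy].
  - have [z z0] := d_nz L; apply: (mulIf z0).
    by rewrite mulrBl -!tE tBl raddfB.
  - have [z z0] := d_nz L; apply: (mulIf z0).
    by rewrite -mulrA -!tE tZl mark_mulr.
  apply/eqP; rewrite -subr_eq0; apply/eqP/pairing_nondegenerate => z.
  apply: (@mark_inj _ abG G) => L _.
  by rewrite tBl raddfB /= !tE exy subrr raddf0.
have dD x y L : d (x + y) L = d x L + d y L.
  by have [m mE] := dE L; rewrite !mE tDr raddfD.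
have dZ u x L : d (u *: x) L = mark L u * d x L.
  by have [m mE] := dE L; rewrite !mE tZr mark_mulr.
have [e eC] : exists e, forall L, coprimez (c e L) n.
  apply: (ex_coprime_coordinates (d := d) (markingD mc) (markingZ mc)) => //.
  by move=> x y; exists (t x y).
have [f fC] : exists f, forall L, coprimez (d f L) n.
  apply: (ex_coprime_coordinates (d := c) dD dZ) => //.
  by move=> y x; exists (t x y) => L; rewrite tE mulrC.
have princ x : exists y : AG, forall L, (n %| c x L - c e L * mark L y)%Z.
  exists (t x f * t e f ^+ (totient #|G|).*2.-1) => L.
  have mX k : mark L (t e f ^+ k) = (c e L * d f L) ^+ k.
    by elim: k => [|k IH]; rewrite ?mark_one // !exprS mark_mulr IH tE.
  rewrite mark_mulr mX tE.
  have cop : coprimez (c e L * d f L) n by rewrite coprimezMl eC fC.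
  have := Euler_coprimez (cardG_gt0 G) cop; rewrite exprS.
  set z := _ ^+ _ => dvd.
  rewrite (_ : _ - _ = - c x L * (c e L * d f L * z - 1)) ?dvdz_mull //.
  by ring.
have [a [ca ra]] : exists a : twist gT, (forall K, coprimez (a K) n) /\
    forall L, (n %| twist_r a L - c e L)%Z.
  apply: (@ex_twist_r _ (fun z => coprimez z n) (fun L z => (n %| z - c e L)%Z)).
  - by rewrite coprimezE coprime1n.
  - by move=> u v cu cv; rewrite coprimezMl cu.
  move=> L z /coprimezP[[u v] /= uv]; exists (c e L * u).
    rewrite coprimezMl eC; apply/coprimezP; exists (z, v); rewrite /= -uv; ring.
  rewrite (_ : _ - _ = (- c e L * v) * n) ?dvdz_mull //.
  by rewrite -[in LHS](mulr1 (c e L)) -[in X in _ - X]uv; ring.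
exists a => //.
have switch g (y : AG) L : (n %| g L - c e L * mark L y)%Z =
    (n %| g L - twist_r a L * mark L y)%Z.
  rewrite (_ : g L - c e L * _ = g L - twist_r a L * mark L y +
    (twist_r a L - c e L) * mark L y); last by ring.
  by rewrite rpredDr // dvdz_mulr.
apply: (marked_iso mc (twisted_marking abG a)) => [x|y].
  have [y yE] := princ x.
  have [w wE] : lattice abG a G (c x).
    by apply/(twisted_principal abG ca); exists y => L; rewrite -switch.
  by exists w => L; rewrite wE ?subsetT.
have /(twisted_principal abG ca)[u uE] := lattice_tmark a (y : AG).
apply/(marked_principal mc c1 princ); exists u => L.
by rewrite (switch (fun L => tmark a L (y : AG))).
Qed.

End Pairing.

Lemma invertible_twisted (M : lmodType AG) : module_invertible M ->
  exists (alpha : T_inv gT) (a : twist gT),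
    represents a alpha /\ module_iso M (twisted_module abG a).
Proof.
case=> N [t bt tu]; have [a ca Ma] := pairing_twisted bt tu.
have [|alpha ra] := @ex_represented _ a; last by exists alpha, a.
by move=> H; apply: coprimez_dvdr (ca H); apply: dvdn_indexg.
Qed.

End InvertibleModules.

Theorem mainTheorem5 (gT : finGroupType) (abG : abelian [set: gT]) :
  [/\ forall alpha : T_inv gT, Pic_kMack abG (twisted_class abG alpha),
      forall alpha : T_inv gT, Pic_kMod (twisted_module_class abG alpha) &
      forall (alpha : T_inv gT) (a : twist gT), represents a alpha ->
        twisted_module_class abG alpha = module_iso (twisted_module abG a)] /\
  [/\ forall alpha beta : T_inv gT,
        twisted_module_class abG (alpha * beta)%g =
          Pic_mul (twisted_module_class abG alpha)
                  (twisted_module_class abG beta),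
      injective (@twisted_module_class gT abG) &
      forall C, Pic C ->
        exists alpha : T_inv gT, twisted_module_class abG alpha = C] /\
  (forall M : lmodType (burnside abG [set: gT]%G), module_invertible M ->
     exists (alpha : T_inv gT) (a : twist gT),
       represents a alpha /\ module_iso M (twisted_module abG a)).
Proof.
split; last split.
- split; [exact: twisted_Pic_kMack | exact: twisted_Pic_kMod |].
  by move=> alpha a; apply: twisted_module_classE.
- split; [exact: twisted_module_classM | exact: twisted_module_class_inj |].
  move=> C [M /invertible_twisted[alpha [a [ra iM]]] ->].
  by exists alpha; rewrite (twisted_module_classE abG ra) (module_iso_class iM).
exact: invertible_twisted.
Qed.
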